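(* Let $p, q$ be integers with $p, q \geq 1$ and $p+q \geq 4$, and let $G = H_3 \times \mathbb{R}^{p+q-3}$. Then the number of equivalence classes, up to scaling and automorphisms, of left-invariant pseudo-Riemannian metrics of signature $(p,q)$ on $G$ is: (1) $21$ if $p, q \geq 3$; (2) $15$ if $p \geq 3$ and $q = 2$; (3) $6$ if $p \geq 3$ and $q = 1$; (4) $10$ if $p = q = 2$.
   Context: $H_3$ denotes the three-dimensional (connected, simply-connected) Heisenberg group. A pseudo-Riemannian metric has signature $(p,q)$ if the induced nondegenerate symmetric bilinear form on each tangent space has $p$ positive and $q$ negative eigenvalues. Two left-invariant pseudo-Riemannian metrics $g_1, g_2$ on a Lie group $G$ are equivalent up to scaling and automorphisms if there exist $c>0$ and a Lie group automorphism $\varphi: G \to G$ such that for all $a \in G$ and $x, y \in T_aG$, $g_1(x,y)_a = c\, g_2(d\varphi_a(x), d\varphi_a(y))_{\varphi(a)}$. *)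

(* Defs.v *)
From HB Require Import structures.
From mathcomp Require Import all_boot all_order all_algebra.
From mathcomp Require Import all_classical all_reals all_analysis.
Set Implicit Arguments. Unset Strict Implicit. Unset Printing Implicit Defensive.
Import Order.TTheory GRing.Theory Num.Theory.
Import numFieldNormedType.Exports.
Local Open Scope ring_scope.

Section Heis.
Variable R : realType.
Variable n : nat.

(* Model of G = H_3 x R^(n-3) on the manifold 'rV[R]_n (n >= 3):
   coordinates 0,1,2 are (x,y,z) of H_3 with
   (x,y,z)(x',y',z') = (x+x', y+y', z+z'+x y'),
   the remaining n-3 coordinates form the abelian factor R^(n-3). *)
Definition Hmul (a b : 'rV[R]_n.+1) : 'rV[R]_n.+1 :=
  a + b + (a ord0 (inord 0) * b ord0 (inord 1)) *: delta_mx ord0 (inord 2).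

(* A field of bilinear forms: at each point a, the Gram matrix g a, so that
   g_a(x,y) = x *m g a *m y^T for tangent vectors x y : 'rV_n (T_a G = R^n). *)
Definition form (M : 'M[R]_n.+1) (x y : 'rV[R]_n.+1) : R := (x *m M *m y^T) ord0 ord0.

(* signature (p,q): symmetric, and orthogonally diagonalizable with exactly
   p positive and q negative eigenvalues (diagonal entries), counted with
   multiplicity; with p + q = dimension this means nondegenerate. *)
Definition has_signature (p q : nat) (M : 'M[R]_n.+1) : Prop :=
  M^T = M /\
  exists (U : 'M[R]_n.+1) (d : 'rV[R]_n.+1),
    U *m U^T = 1%:M /\ U^T *m M *m U = diag_mx d /\
    #|[set i | 0 < d ord0 i]| = p /\ #|[set i | d ord0 i < 0]| = q.

Definition li_metric (p q : nat) (g : 'rV[R]_n.+1 -> 'M[R]_n.+1) : Prop :=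
  (forall a, has_signature p q (g a)) /\
  forall b a x y,
    form (g a) x y = form (g (Hmul b a)) ('d (Hmul b) a x) ('d (Hmul b) a y).

Definition lie_aut (phi : 'rV[R]_n.+1 -> 'rV[R]_n.+1) : Prop :=
  bijective phi /\ (forall a b, phi (Hmul a b) = Hmul (phi a) (phi b)) /\
  (forall a, differentiable phi a).

Definition metric_equiv (g1 g2 : 'rV[R]_n.+1 -> 'M[R]_n.+1) : Prop :=
  exists (c : R) (phi : 'rV[R]_n.+1 -> 'rV[R]_n.+1),
    0 < c /\ lie_aut phi /\
    forall a x y, form (g1 a) x y = c * form (g2 (phi a)) ('d phi a x) ('d phi a y).

Definition num_classes (p q k : nat) : Prop :=
  exists m : 'I_k -> ('rV[R]_n.+1 -> 'M[R]_n.+1),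
    (forall i, li_metric p q (m i)) /\
    (forall i j, i != j -> ~ metric_equiv (m i) (m j)) /\
    (forall g, li_metric p q g -> exists i, metric_equiv g (m i)).

End Heis.

(* Main.v *)
Require Import Defs.
From HB Require Import structures.
From mathcomp Require Import all_boot all_order all_algebra.
From mathcomp Require Import all_classical all_reals all_analysis.
From mathcomp Require Import all_fingroup complex ring lra zify.
Set Implicit Arguments. Unset Strict Implicit. Unset Printing Implicit Defensive.
Import Order.TTheory GRing.Theory Num.Theory.
Import numFieldNormedType.Exports.
Local Open Scope ring_scope.

(* A left-invariant metric is its Gram matrix at the identity. Every linear map preserving the flag
   L = [h_3, h_3] < Z = center is a scalar multiple of a Lie algebra automorphism, so the classes
   are the orbits of this parabolic group on the forms of signature (p, q), i.e. the orbits of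
   O(p, q) on pairs (L, U) with U the orthogonal of Z: a line and a plane orthogonal to each other.
   By Witt's extension theorem such a pair is determined by the isometry type of (L, U): either L is
   not in U and the type is the sign of L together with the signature of U (3 * 6 cases), or L lies
   in the radical of U and the type is the sign of the other diagonal entry (3 cases). A type with
   a, b, c positive, negative and null vectors in an orthogonal basis of L + U occurs if and only if
   a + c <= p and b + c <= q, and the four numbers count the types satisfying these inequalities. *)

(** * Reflections and the spectral theorem *)

(** Working with [U] instead of [Z] keeps the data small: [U] has dimension 2 whatever [n] is, so a
    type has at most three entries. [L] and [U] are orthogonal because [L] lies in [Z]; this makes
    the Gram matrix block diagonal and forces [L] into the radical of [U] as soon as it lies in [U].
    The form may degenerate on [L + U], so orthogonal complements are of no help there, and Witt's
    theorem is needed for arbitrary independent families. Automorphisms are differentiable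
    bijections of the group, not linear maps. That their differentials preserve the flag is read off
    from group identities along lines through the identity; conversely, a flag-preserving map with
    the right determinant is integrated by an explicit quadratic polynomial, so no exponential map
    enters. *)

Definition bil (R : comNzRingType) n (M : 'M[R]_n) (x y : 'rV[R]_n) : R :=
  (x *m M *m y^T) 0 0.

Lemma bilE (R : comNzRingType) n (M : 'M[R]_n) x y : x *m M *m y^T = (bil M x y)%:M.
Proof. by rewrite [LHS]mx11_scalar. Qed.

Lemma bil_eq0 (R : comNzRingType) n (M : 'M[R]_n) x y :
  (bil M x y = 0) <-> (x *m M *m y^T = 0).
Proof. by rewrite /bil; split=> [h|->]; rewrite ?mxE // [LHS]mx11_scalar h raddf0. Qed.

Lemma bilDl (R : comNzRingType) n (M : 'M[R]_n) x y z :
  bil M (x + y) z = bil M x z + bil M y z.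
Proof. by rewrite /bil !mulmxDl mxE. Qed.

Lemma bilDr (R : comNzRingType) n (M : 'M[R]_n) x y z :
  bil M x (y + z) = bil M x y + bil M x z.
Proof. by rewrite /bil linearD /= mulmxDr mxE. Qed.

Lemma bilZl (R : comNzRingType) n (M : 'M[R]_n) a x y : bil M (a *: x) y = a * bil M x y.
Proof. by rewrite /bil -!scalemxAl mxE. Qed.

Lemma bilZr (R : comNzRingType) n (M : 'M[R]_n) a x y : bil M x (a *: y) = a * bil M x y.
Proof. by rewrite /bil linearZ /= -scalemxAr mxE. Qed.

Lemma bilNl (R : comNzRingType) n (M : 'M[R]_n) x y : bil M (- x) y = - bil M x y.
Proof. by rewrite -scaleN1r bilZl mulN1r. Qed.

Lemma bilNr (R : comNzRingType) n (M : 'M[R]_n) x y : bil M x (- y) = - bil M x y.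
Proof. by rewrite -scaleN1r bilZr mulN1r. Qed.

Definition bil_lin := (bilDl, bilDr, bilNl, bilNr, bilZl, bilZr).

Lemma bilC (R : comNzRingType) n (M : 'M[R]_n) x y : M^T = M -> bil M x y = bil M y x.
Proof.
move=> sM; rewrite /bil.
by rewrite -[x *m M *m y^T]trmxK mxE !trmx_mul trmxK sM mulmxA.
Qed.

Lemma bil_mul (R : comNzRingType) n m (M : 'M[R]_n) (A : 'M[R]_(m, n)) x y :
  bil (A *m M *m A^T) x y = bil M (x *m A) (y *m A).
Proof. by rewrite /bil trmx_mul !mulmxA. Qed.

Lemma bil_row (R : comNzRingType) m n p (M : 'M[R]_n) (A : 'M[R]_(m, n)) (B : 'M[R]_(p, n)) i j :
  bil M (row i A) (row j B) = (A *m M *m B^T) i j.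
Proof.
rewrite /bil -!row_mul !mxE; apply: eq_bigr => k _; by rewrite !mxE.
Qed.

Lemma bilP (R : comNzRingType) n (M N : 'M[R]_n) :
  (forall x y, bil M x y = bil N x y) -> M = N.
Proof.
move=> h; apply/matrixP=> i j.
have := h (row i 1%:M) (row j 1%:M).
by rewrite !bil_row trmx1 !mul1mx !mulmx1.
Qed.

(* The reflection [x |-> x - 2 b(x, w) / b(w, w) w]. *)
Definition refl (R : fieldType) n (M : 'M[R]_n) (w : 'rV[R]_n) : 'M[R]_n :=
  1%:M - (2 / bil M w w) *: (M *m w^T *m w).

Lemma mul_refl (R : fieldType) n (M : 'M[R]_n) w x :
  x *m refl M w = x - (2 * bil M x w / bil M w w) *: w.
Proof.
rewrite /refl mulmxBr mulmx1 -scalemxAr !mulmxA bilE mul_scalar_mx scalerA.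
by rewrite mulrAC.
Qed.

Lemma refl_isom (R : fieldType) n (M : 'M[R]_n) w :
  M^T = M -> bil M w w != 0 -> refl M w *m M *m (refl M w)^T = M.
Proof.
move=> sM w0; apply: bilP => x y; rewrite bil_mul !mul_refl !bil_lin (bilC w y) //.
by field.
Qed.

Lemma refl_swap (R : fieldType) n (M : 'M[R]_n) u v :
  M^T = M -> bil M u u = bil M v v -> bil M (u - v) (u - v) != 0 ->
  u *m refl M (u - v) = v.
Proof.
move=> sM quv w0; rewrite mul_refl.
have E : bil M (u - v) (u - v) = 2 * bil M u (u - v).
  by rewrite !bil_lin (bilC v u) // quv; ring.
by rewrite -E divff // scale1r opprB addrC subrK.
Qed.

Lemma bil1_gt0 (R : realDomainType) n (x : 'rV[R]_n) : x != 0 -> 0 < bil 1%:M x x.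
Proof.
move=> x0; have E : bil 1%:M x x = \sum_i x 0 i ^+ 2.
  by rewrite /bil mulmx1 mxE; apply: eq_bigr => i _; rewrite mxE expr2.
rewrite lt_neqAle E sumr_ge0 ?andbT; last by move=> i _; exact: sqr_ge0.
rewrite eq_sym psumr_eq0; last by move=> i _; exact: sqr_ge0.
apply: contra_neqN x0 => /allP h; apply/rowP => i; rewrite mxE.
by apply/eqP; rewrite -sqrf_eq0; apply: h; rewrite mem_index_enum.
Qed.

(** Over the complexification [M] is Hermitian and has some eigenvalue; unitary diagonalization
    makes it an entry of a real diagonal, and being a root of the characteristic polynomial descends
    to [R]. *)
Lemma sym_eigenvalue (R : rcfType) n (M : 'M[R]_n.+1) : M^T = M ->
  exists a, eigenvalue M a.
Proof.
move=> sM; pose A := map_mx (real_complex R) M.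
have hA : A \is hermsymmx.
  apply: realsym_hermsym.
    by apply/is_hermitianmxP; rewrite expr0 scale1r map_mx_id // /A map_trmx sM.
  by apply/mxOverP => i j; rewrite mxE complex_real.
have := hermitian_spectral_diag_real hA; set d := spectral_diag A => dr.
have /hermitian_normalmx /orthomx_spectralP AE := hA.
have [a av] := @eigenvalue_closed _ n.+1 A isT.
have [v vA v0] := eigenvalueP av.
have Pu := spectral_unit A.
pose w := v *m invmx (spectralmx A).
have wd : w *m diag_mx d = a *: w.
  apply: (can_inj (mulmxK Pu)); rewrite -scalemxAl mulmxKV // -vA.
  by rewrite /w -(mulmxA v) -(mulmxA v) -AE.
have w0 : w != 0.
  apply: contra_neq v0 => h; rewrite -[v](mulmxKV Pu) -/w h; exact: mul0mx.
have [i wi] : exists i, w 0 i != 0 by apply/rV0Pn.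
have di : d 0 i = a.
  have := congr1 (fun X : 'rV__ => X 0 i) wd.
  by rewrite mul_mx_diag [LHS]mxE [RHS]mxE mulrC => /(mulIf wi).
have /complex_realP [k dk] : d 0 i \is Num.real by move/mxOverP: dr; apply.
exists k; move: av; rewrite !eigenvalue_root_char.
by rewrite -di dk -map_char_poly fmorph_root.
Qed.

Theorem sym_orthodiag (R : rcfType) n (M : 'M[R]_n) : M^T = M ->
  exists (U : 'M[R]_n) (d : 'rV[R]_n), U *m U^T = 1%:M /\ U^T *m M *m U = diag_mx d.
Proof.
elim: n M => [|n IH] M sM.
  by exists 1%:M, 0; split; apply/matrixP => -[].
have [a /eigenvalueP [v0 v0M v00]] := sym_eigenvalue sM.
pose v := (Num.sqrt (bil 1%:M v0 v0))^-1 *: v0.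
have q0 := bil1_gt0 v00.
have qv : bil 1%:M v v = 1.
  rewrite !bil_lin mulrA -invfM -expr2 sqr_sqrtr ?mulVf ?gt_eqF ?ltW //.
have vM : v *m M = a *: v by rewrite -scalemxAl v0M !scalerA mulrC.
pose e : 'rV[R]_n.+1 := delta_mx 0 0.
have qe : bil 1%:M e e = 1 by rewrite /bil mulmx1 trmx_delta mul_delta_mx mxE.
(* The Euclidean reflection in [e - v] is symmetric, orthogonal and sends [e] to the unit
   eigenvector [v]; conjugation by it splits off a block of size 1. *)
have [H [HH He Hs]] : exists H : 'M[R]_n.+1, [/\ H *m H^T = 1%:M, e *m H = v & H^T = H].
  have [->|ev] := eqVneq e v.
    by exists 1%:M; rewrite trmx1 !mulmx1.
  have w0 : bil 1%:M (e - v) (e - v) != 0 by rewrite gt_eqF // bil1_gt0 // subr_eq0.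
  exists (refl 1%:M (e - v)); split.
  - have := refl_isom (trmx1 _ _) w0; by rewrite mulmx1.
  - by apply: refl_swap => //; rewrite ?trmx1 ?qe.
  - by rewrite /refl linearB /= linearZ /= trmx1 !mul1mx trmx_mul trmxK.
pose M' := H *m M *m H^T : 'M[R]_(1 + n).
have sM' : M'^T = M' by rewrite /M' !trmx_mul trmxK sM mulmxA.
have eM' : e *m M' = a *: e.
  by rewrite /M' !mulmxA He vM -scalemxAl -He -mulmxA HH mulmx1.
have M'd : H *m M *m H^T = M' by [].
clearbody M'.
have M'E : M' = block_mx a%:M 0 0 (drsubmx M').
  rewrite -[LHS]submxK.
  have ur : forall j, M' 0 j = a * (j == 0)%:R.
    move=> j; have := congr1 (fun X : 'rV__ => X 0 j) eM'.
    by rewrite -rowE !mxE eqxx.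
  congr block_mx.
  - by apply/matrixP => i j; rewrite !ord1 !mxE !lshift0 ur eqxx mulr1.
  - by apply/matrixP => i j; rewrite ord1 !mxE lshift0 ur; case: eqP; rewrite ?mulr0.
  - apply/matrixP => i j; rewrite ord1 -sM' !mxE lshift0 ur; case: eqP; by rewrite ?mulr0.
have [U [d [UU Ud]]] := IH (drsubmx M') (etrans (trmx_drsub _) (congr1 drsubmx sM')).
pose B : 'M[R]_(1 + n) := block_mx 1%:M 0 0 U.
have BB : B *m B^T = 1%:M.
  rewrite /B tr_block_mx mulmx_block !trmx0 !mulmx0 !mul0mx !addr0 !add0r UU trmx1 mulmx1.
  by rewrite -scalar_mx_block.
have BMB : B^T *m M' *m B = diag_mx (row_mx a%:M d).
  rewrite M'E /B tr_block_mx !mulmx_block !trmx0 trmx1.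
  rewrite !(mulmx0, mul0mx, addr0, add0r, mul1mx, mulmx1) Ud diag_mx_row.
  by congr block_mx; apply/matrixP => i j; rewrite !ord1 !mxE.
exists (H^T *m B), (row_mx a%:M d); split.
  rewrite trmx_mul trmxK !mulmxA -(mulmxA H^T) BB mulmx1.
  exact: mulmx1C.
by rewrite -BMB -M'd trmx_mul trmxK !mulmxA.
Qed.

(** * Inertia *)

Lemma bil_diag (R : comNzRingType) n (d : 'rV[R]_n) x y :
  bil (diag_mx d) x y = \sum_i d 0 i * x 0 i * y 0 i.
Proof.
rewrite /bil mul_mx_diag mxE; apply: eq_bigr => i _; rewrite !mxE.
by rewrite (mulrC (d 0 i)).
Qed.

Lemma mul_row_free_eq0 (R : fieldType) m n p (F : 'M[R]_(m, n)) (x : 'M[R]_(p, m)) :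
  row_free F -> x *m F = 0 -> x = 0.
Proof. by move=> rF; rewrite -(mul0mx _ F); apply: row_free_inj. Qed.

(** If there were more nonnegative [e 0 i] than nonnegative [d 0 j], some nonzero combination of the
    corresponding rows of [F] would have zero coordinates wherever [d 0 j >= 0]; its norm would be
    both nonnegative and negative. For square [F], used in both directions, this is Sylvester's law;
    for rectangular [F] it bounds the restriction to a subspace. *)
Lemma card_nonneg_le (R : realFieldType) k n (F : 'M[R]_(k, n)) (e : 'rV[R]_k) (d : 'rV[R]_n) :
  row_free F -> F *m diag_mx d *m F^T = diag_mx e ->
  (#|[set i | (0 <= e 0 i)%R]| <= #|[set i | (0 <= d 0 i)%R]|)%N.
Proof.
move=> rF Fde; set A := [set i | _]; set C := [set i | (0 <= d 0 i)%R].
pose SA : 'M[R]_(#|A|, k) := \matrix_(a, i) (enum_val a == i)%:R.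
pose SC : 'M[R]_(n, #|C|) := \matrix_(j, c) (enum_val c == j)%:R.
suff /eqP <- : row_free (SA *m F *m SC) by exact: rank_leq_col.
apply: inj_row_free => y; rewrite !mulmxA; set x := y *m SA; set w := x *m F => wC.
have w0 j : j \in C -> w 0 j = 0.
  move=> jC; have := congr1 (fun X : 'rV__ => X 0 (enum_rank_in jC j)) wC.
  rewrite [LHS]mxE (bigD1 j) //= big1 ?addr0 => [|i ij].
    by rewrite !mxE enum_rankK_in // eqxx mulr1.
  by rewrite [SC _ _]mxE enum_rankK_in // eq_sym (negbTE ij) mulr0.
have x0 i : i \notin A -> x 0 i = 0.
  move=> iA; rewrite /x mxE big1 // => a _; rewrite mxE; case: eqP => [ai|]; last by rewrite mulr0.
  by move: iA; rewrite -ai enum_valP.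
have xE a : x 0 (enum_val a) = y 0 a.
  rewrite /x mxE (bigD1 a) //= big1 ?addr0 => [|b ba]; first by rewrite mxE eqxx mulr1.
  by rewrite mxE (inj_eq enum_val_inj) (negbTE ba) mulr0.
have qq : bil (diag_mx e) x x = bil (diag_mx d) w w by rewrite -Fde bil_mul.
have q0 : 0 <= bil (diag_mx e) x x.
  rewrite bil_diag sumr_ge0 // => i _; have [|/x0 ->] := boolP (i \in A); last by rewrite !mulr0.
  by rewrite inE => ei; rewrite -mulrA mulr_ge0 // -expr2 sqr_ge0.
have dw j : 0 <= - (d 0 j * w 0 j * w 0 j).
  have [/w0 ->|] := boolP (j \in C); first by rewrite !mulr0 oppr0.
  rewrite inE -ltNge => dj; rewrite oppr_ge0 -mulrA mulr_le0_ge0 ?(ltW dj) //.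
  by rewrite -expr2 sqr_ge0.
have /allP wz : all (fun j => - (d 0 j * w 0 j * w 0 j) == 0) (index_enum 'I_n).
  rewrite -(@psumr_eq0 _ _ _ xpredT) // sumrN oppr_eq0 eq_le -bil_diag -qq q0 andbT.
  by rewrite qq bil_diag -oppr_ge0 -sumrN sumr_ge0.
have w00 : w = 0.
  apply/rowP => j; rewrite [RHS]mxE; have [/w0 //|] := boolP (j \in C).
  rewrite inE -ltNge => dj; have := wz j (mem_index_enum j).
  by rewrite oppr_eq0 -mulrA mulf_eq0 (lt_eqF dj) /= -expr2 sqrf_eq0 => /eqP.
have xz := mul_row_free_eq0 rF w00.
by apply/rowP => a; rewrite -xE xz !mxE.
Qed.

Lemma card_nonpos_le (R : realFieldType) k n (F : 'M[R]_(k, n)) (e : 'rV[R]_k) (d : 'rV[R]_n) :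
  row_free F -> F *m diag_mx d *m F^T = diag_mx e ->
  (#|[set i | (e 0 i <= 0)%R]| <= #|[set i | (d 0 i <= 0)%R]|)%N.
Proof.
move=> rF Fde; have := @card_nonneg_le _ _ _ F (- e) (- d) rF.
rewrite [diag_mx (- d)]linearN [diag_mx (- e)]linearN /= mulmxN mulNmx Fde => /(_ erefl).
congr (_ <= _)%N; apply: eq_card => i; by rewrite !inE !mxE oppr_ge0.
Qed.

Definition sgnv (R : realFieldType) k (e : 'rV[R]_k) :=
  forall i, e 0 i = 1 \/ e 0 i = 0 \/ e 0 i = -1.

Lemma sym_signdiag (R : rcfType) n (M : 'M[R]_n) : M^T = M ->
  exists (A : 'M[R]_n) (e : 'rV[R]_n), [/\ A \in unitmx, A *m M *m A^T = diag_mx e & sgnv e].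
Proof.
move=> sM; have [U [d [UU Ud]]] := sym_orthodiag sM.
(* The value 1 at a zero eigenvalue keeps the rescaling invertible. *)
pose s i : R := if d 0 i == 0 then 1 else (Num.sqrt `|d 0 i|)^-1.
pose e : 'rV[R]_n := \row_i Num.sg (d 0 i).
have s0 i : s i != 0.
  rewrite /s; have [_|di] := eqVneq (d 0 i) 0; first exact: oner_neq0.
  by rewrite invr_eq0 sqrtr_eq0 -ltNge normr_gt0.
exists (diag_mx (\row_i s i) *m U^T), e; split.
- rewrite unitmx_mul unitmx_tr (mulmx1_unit UU).1 andbT unitmxE det_diag unitfE.
  by apply/prodf_neq0 => i _; rewrite mxE.
- rewrite trmx_mul trmxK tr_diag_mx !mulmxA -(mulmxA _ _ M) -(mulmxA _ (_ *m M)) Ud.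
  rewrite mul_diag_mx mul_mx_diag; apply/matrixP => i j; rewrite !mxE.
  case: eqP => [<-|]; last by rewrite !mulr0n mulr0 mul0r.
  rewrite !mulr1n /s; have [->|di] := eqVneq (d 0 i) 0; first by rewrite sgr0 mulr0 mul0r.
  rewrite mulrAC -invfM -expr2 sqr_sqrtr ?normr_ge0 //.
  rewrite {2}[d 0 i]numEsg mulrCA mulVf ?mulr1 //.
  by rewrite normr_eq0.
- move=> i; rewrite mxE; case: sgrP; auto.
Qed.

(** * Witt's extension theorem *)

Lemma refl_fix (R : fieldType) m n (M : 'M[R]_n) w (W : 'M[R]_(m, n)) :
  W *m M *m w^T = 0 -> W *m refl M w = W.
Proof. by move=> h; rewrite /refl mulmxBr mulmx1 -scalemxAr !mulmxA h mul0mx scaler0 subr0. Qed.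

(* The Eichler (Siegel) transvection attached to an isotropic [s] and [y] orthogonal to [s]. *)
Definition eichler (R : fieldType) n (M : 'M[R]_n) (s y : 'rV[R]_n) : 'M[R]_n :=
  1%:M + M *m s^T *m y - M *m y^T *m s - (bil M y y / 2) *: (M *m s^T *m s).

Lemma mul_eichler (R : fieldType) n (M : 'M[R]_n) s y x :
  x *m eichler M s y =
  x + bil M x s *: y - bil M x y *: s - (bil M y y / 2 * bil M x s) *: s.
Proof.
rewrite /eichler !mulmxBr mulmxDr mulmx1 -scalemxAr !mulmxA !bilE !mul_scalar_mx.
by rewrite scalerA.
Qed.

Lemma eichler_isom (R : realFieldType) n (M : 'M[R]_n) s y :
  M^T = M -> bil M s s = 0 -> bil M s y = 0 ->
  eichler M s y *m M *m (eichler M s y)^T = M.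
Proof.
move=> sM ss sy; apply: bilP => x z; rewrite bil_mul !mul_eichler !bil_lin.
by rewrite (bilC y s) // (bilC y z) // (bilC s z) // ss sy; field.
Qed.

Lemma eichler_fix (R : fieldType) m n (M : 'M[R]_n) s y (W : 'M[R]_(m, n)) :
  W *m M *m s^T = 0 -> W *m M *m y^T = 0 -> W *m eichler M s y = W.
Proof.
move=> hs hy; rewrite /eichler !mulmxBr mulmxDr mulmx1 -scalemxAr !mulmxA hs hy.
by rewrite !mul0mx scaler0 addr0 !subr0.
Qed.

Lemma row_free_dual (R : fieldType) m n (M : 'M[R]_n) (A : 'M[R]_(m, n)) (c : 'cV[R]_m) :
  M \in unitmx -> row_free A -> exists y : 'rV[R]_n, A *m M *m y^T = c.
Proof.
move=> uM /row_freeP [B AB]; exists (invmx M *m B *m c)^T.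
by rewrite trmxK !mulmxA mulmxK // AB mul1mx.
Qed.

(* Let s = u - v be isotropic. If some y orthogonal to W has b(u, y) = 1 and b(s, y) = 0, an Eichler
   transvection works. Otherwise s = a u + w with w in W and a <> 0, and the isometry sought fixes W
   and multiplies s by 1 - a: reflect s to an isotropic z with b(s, z) = 1, then z to (1 - a) s. *)
Lemma witt_step (R : realFieldType) k n (M : 'M[R]_n) (W : 'M[R]_(k, n)) (u v : 'rV[R]_n) :
  M^T = M -> M \in unitmx ->
  row_free (col_mx u W) -> row_free (col_mx v W) ->
  W *m M *m u^T = W *m M *m v^T -> bil M u u = bil M v v ->
  exists g : 'M[R]_n, [/\ g *m M *m g^T = M, W *m g = W & u *m g = v].
Proof.
move=> sM uM fu fv Wuv quv; pose s := u - v.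
have Ws : W *m M *m s^T = 0 by rewrite linearB /= mulmxBr Wuv subrr.
have [qs|qs] := eqVneq (bil M s s) 0; last first.
  by exists (refl M s); rewrite refl_isom // refl_fix // refl_swap.
have us : bil M u s = 0.
  have : bil M s s = 2 * bil M u s by rewrite /s !bil_lin (bilC v u) // quv; ring.
  by rewrite qs; lra.
have vE : v = u - s by rewrite /s opprB addrC subrK.
clearbody s.
have eich y : W *m M *m y^T = 0 -> bil M u y = 1 -> bil M s y = 0 ->
    exists g : 'M[R]_n, [/\ g *m M *m g^T = M, W *m g = W & u *m g = v].
  move=> Wy uy sy; exists (eichler M s y); rewrite eichler_isom // eichler_fix //.
  by split=> //; rewrite mul_eichler us uy mulr0 !scale0r scale1r addr0 subr0 vE.
have [] := boolP (s <= col_mx u W)%MS; last first.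
  move=> sN.
  have f3 : row_free (col_mx s (col_mx u W)).
    rewrite -row_leq_rank -addsmxE mxrank_disjoint_sum.
      rewrite (eqP fu) rank_rV; case: eqP => // s0; by rewrite s0 sub0mx in sN.
    apply/eqP; apply: contraNT sN => /rowV0Pn [w].
    rewrite sub_capmx => /andP [/sub_rVP [a ->] sub] n0.
    by move: n0 sub; rewrite scaler_eq0 => /norP [a0 _]; rewrite (eqmx_scale _ a0).
  have [y] := row_free_dual (col_mx 0 (col_mx 1%:M 0) : 'cV[R]_(1 + (1 + k))) uM f3.
  rewrite !mul_col_mx => /eq_col_mx [sy /eq_col_mx [uy Wy]].
  by apply: (eich y) => //; rewrite /bil ?sy ?uy !mxE.
rewrite -addsmxE => /sub_addsmxP [[a' c]] /=; rewrite [a']mx11_scalar mul_scalar_mx.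
set a := a' 0 0; set w := c *m W => sE.
have [y] := row_free_dual (col_mx 1%:M 0 : 'cV[R]_(1 + k)) uM fu.
rewrite !mul_col_mx => /eq_col_mx [uy Wy].
have {}uy : bil M u y = 1 by rewrite /bil uy !mxE.
have wy : bil M w y = 0 by apply/bil_eq0; rewrite /w -!mulmxA (mulmxA W) Wy mulmx0.
have sy : bil M s y = a by rewrite sE !bil_lin uy wy mulr1 addr0.
have [a0|a0] := eqVneq a 0; first by apply: (eich y); rewrite ?sy.
(* With [a = 1], [v] would be [- w], in the span of [W], against [fv]. *)
have b0 : 1 - a != 0.
  apply/negP => /eqP a1; have {}a1 : a = 1 by lra.
  have vw : v = - w by rewrite vE {1}sE a1 scale1r opprD addNKr.
  have := @mul_row_free_eq0 _ _ _ _ _ (row_mx 1%:M c) fv.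
  rewrite mul_row_col mul1mx vw addNr => /(_ erefl) /(congr1 lsubmx).
  by rewrite row_mxKl linear0 => /matrixP /(_ 0 0); rewrite !mxE => /eqP; rewrite oner_eq0.
(* As [s] is isotropic with product [a] against [y], subtracting this multiple of [s] makes [y]
   isotropic; the factor [a^-1] normalizes the product with [s] to 1. *)
pose z := a^-1 *: (y - (bil M y y / 2 / a) *: s).
have sz : bil M s z = 1 by rewrite !bil_lin sy qs; field.
have zz : bil M z z = 0 by rewrite !bil_lin (bilC y s) // sy qs; field.
have Wz : W *m M *m z^T = 0.
  rewrite /z [(_ *: _)^T]linearZ /= [(_ - _)^T]linearB /= [(_ *: _)^T]linearZ /=.
  by rewrite -scalemxAr mulmxBr -scalemxAr Wy Ws scaler0 subr0 scaler0.
clearbody z.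
have q1 : bil M (s - z) (s - z) != 0.
  have -> : bil M (s - z) (s - z) = - 2 by rewrite !bil_lin (bilC z s) // sz zz qs; ring.
  by rewrite oppr_eq0 pnatr_eq0.
have q2 : bil M (z - (1 - a) *: s) (z - (1 - a) *: s) != 0.
  have -> : bil M (z - (1 - a) *: s) (z - (1 - a) *: s) = - 2 * (1 - a).
    by rewrite !bil_lin (bilC z s) // sz zz qs; ring.
  by rewrite mulf_neq0 // oppr_eq0 pnatr_eq0.
set w1 := s - z; set w2 := z - (1 - a) *: s.
have Ww1 : W *m M *m w1^T = 0 by rewrite /w1 [(_ - _)^T]linearB /= mulmxBr Ws Wz subr0.
have Ww2 : W *m M *m w2^T = 0.
  rewrite /w2 [(_ - _)^T]linearB /= [(_ *: _)^T]linearZ /= mulmxBr -scalemxAr.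
  by rewrite Ws Wz scaler0 subr0.
have s1 : s *m refl M w1 = z by rewrite refl_swap // qs zz.
have s2 : z *m refl M w2 = (1 - a) *: s by rewrite refl_swap // !bil_lin qs zz !mulr0.
have [g [gM Wg sg]] : exists g : 'M[R]_n, [/\ g *m M *m g^T = M, W *m g = W & s *m g = (1 - a) *: s].
  exists (refl M w1 *m refl M w2); split.
  - rewrite trmx_mul !mulmxA -(mulmxA _ _ M) -(mulmxA _ (_ *m M)) refl_isom //.
    exact: refl_isom.
  - by rewrite mulmxA (refl_fix Ww1) (refl_fix Ww2).
  - by rewrite mulmxA s1 s2.
exists g; split=> //.
(* Hence [g] sends [u] to [a^-1 ((1 - a) s - w) = u - s = v]. *)
have uE : u = a^-1 *: (s - w) by rewrite {1}sE addrK scalerA mulVf // scale1r.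
rewrite vE {1}uE -scalemxAl mulmxBl sg /w -mulmxA Wg -/w scalerBl scale1r.
by rewrite -addrAC scalerBr -uE scalerA mulVf // scale1r.
Qed.

(** Rows are matched one at a time: once [g] carries the lower rows of [F1] to those of [F2],
    [witt_step] corrects the image of the top row while fixing the others. The common Gram matrix
    may be singular. *)
Theorem witt_ext (R : realFieldType) k n (M : 'M[R]_n) (F1 F2 : 'M[R]_(k, n)) :
  M^T = M -> M \in unitmx -> row_free F1 -> row_free F2 ->
  F1 *m M *m F1^T = F2 *m M *m F2^T ->
  exists g : 'M[R]_n, g *m M *m g^T = M /\ F1 *m g = F2.
Proof.
move=> sM uM; elim: k F1 F2 => [|k IH] F1 F2.
  by exists 1%:M; rewrite mul1mx trmx1 mulmx1; split=> //; apply/matrixP => -[].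
rewrite -[k.+1]/(1 + k)%N in F1 F2 *.
rewrite -(vsubmxK F1) -(vsubmxK F2).
set u1 := usubmx _; set W1 := dsubmx _; set u2 := usubmx _; set W2 := dsubmx _.
move=> f1 f2; rewrite !tr_col_mx !mul_col_mx !mul_mx_row => /eq_col_mx [].
move=> /eq_row_mx [Euu _] /eq_row_mx [EWu EWW].
have fW (u : 'rV[R]_n) (W : 'M[R]_(k, n)) : row_free (col_mx u W) -> row_free W.
  move=> f; apply: inj_row_free => x xW.
  have := @mul_row_free_eq0 _ _ _ _ _ (row_mx 0 x) f.
  by rewrite mul_row_col mul0mx xW addr0 => /(_ erefl) /(congr1 rsubmx); rewrite row_mxKr linear0.
have [g [gM Wg]] := IH _ _ (fW _ _ f1) (fW _ _ f2) EWW.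
have ug : g \in unitmx.
  have : g *m M *m g^T \in unitmx by rewrite gM.
  by rewrite !unitmx_mul => /andP [/andP []].
have [] := @witt_step _ _ _ M W2 (u1 *m g) u2 sM uM _ f2.
- by rewrite -Wg -mul_col_mx /row_free mxrankMfree // row_free_unit.
- by rewrite -EWu -Wg trmx_mul !mulmxA -(mulmxA W1) -(mulmxA W1) gM.
- by rewrite -bil_mul gM /bil Euu.
move=> h [hM Wh uh]; exists (g *m h); split.
  by rewrite trmx_mul !mulmxA -(mulmxA g h M) -(mulmxA g) hM.
by rewrite mul_col_mx !mulmxA uh Wg Wh.
Qed.

(** * Forms of a given signature *)

Definition sig_std (R : rcfType) n (p : nat) : 'rV[R]_n := \row_i (if (i < p)%N then 1 else -1).

(* [has_signature] over an arbitrary real closed field; at a [realType] the two are convertible. *)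
Definition hsig (R : rcfType) n (p q : nat) (M : 'M[R]_n.+1) : Prop :=
  M^T = M /\
  exists (U : 'M[R]_n.+1) (d : 'rV[R]_n.+1),
    U *m U^T = 1%:M /\ U^T *m M *m U = diag_mx d /\
    #|[set i | 0 < d ord0 i]| = p /\ #|[set i | d ord0 i < 0]| = q.

Lemma card_sign (R : realFieldType) n (d : 'rV[R]_n) :
  (#|[set i | (0 <= d 0 i)%R]| + #|[set i | (d 0 i < 0)%R]| = n)%N /\
  (#|[set i | (0 < d 0 i)%R]| + #|[set i | (d 0 i <= 0)%R]| = n)%N.
Proof.
have c P : (#|[set i : 'I_n | P i]| + #|[set i : 'I_n | ~~ P i]| = n)%N.
  rewrite -[RHS]card_ord -(cardsC [set i | P i]); congr (_ + _)%N.
  by apply: eq_card => i; rewrite !inE.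
split; first by rewrite -[RHS](c (fun i => 0 <= d 0 i)); congr (_ + _)%N;
  apply: eq_card => i; rewrite !inE ltNge.
by rewrite -[RHS](c (fun i => 0 < d 0 i)); congr (_ + _)%N;
  apply: eq_card => i; rewrite !inE leNgt.
Qed.

Lemma card_ltn_ord n p : (p <= n)%N -> #|[set i : 'I_n | (i < p)%N]| = p.
Proof.
move=> pn; have inj : injective (widen_ord pn).
  by move=> i j /(congr1 val) /= /val_inj.
rewrite -[RHS]card_ord -(card_imset _ inj).
apply: eq_card => i; rewrite !inE; apply/idP/imsetP => [ip|[j _ ->]] //=.
by exists (Ordinal ip) => //; apply: val_inj.
Qed.

Lemma sig_std_ge0 (R : rcfType) n p i : (0 <= (sig_std R n p) 0 i) = (i < p)%N.
Proof. by rewrite mxE; case: ifP; rewrite ?ler01 // oppr_ge0 ler10. Qed.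

Lemma sig_std_le0 (R : rcfType) n p i : ((sig_std R n p) 0 i <= 0) = ~~ (i < p)%N.
Proof. by rewrite mxE; case: ifP; rewrite ?oppr_le0 ?ler01 // ler10. Qed.

Lemma card_sig_std (R : rcfType) n p q : (p + q = n)%N ->
  #|[set i | (0 <= (sig_std R n p) 0 i)%R]| = p /\
  #|[set i | ((sig_std R n p) 0 i <= 0)%R]| = q.
Proof.
move=> pq; have E : #|[set i | (0 <= (sig_std R n p) 0 i)%R]| = p.
  rewrite -[RHS](@card_ltn_ord n); last by rewrite -pq leq_addr.
  by apply: eq_card => i; rewrite !inE sig_std_ge0.
split=> //; have h := cardsC [set i | (0 <= (sig_std R n p) 0 i)%R].
apply: (@addnI p); rewrite pq -[RHS]card_ord -h E; congr (_ + _)%N; apply: eq_card => i.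
by rewrite !inE sig_std_ge0 sig_std_le0.
Qed.

Lemma sig_std_unit (R : rcfType) n p : diag_mx (sig_std R n p) \in unitmx.
Proof.
rewrite unitmxE det_diag unitfE; apply/prodf_neq0 => i _.
by rewrite mxE; case: ifP; rewrite ?oppr_eq0 oner_eq0.
Qed.

(** By inertia, an orthogonal diagonalization has at most [p] nonnegative and at most [q]
    nonpositive entries; as [p + q] is the dimension, no entry vanishes and both bounds are
    attained. *)
Lemma hsig_of_std (R : rcfType) n p q (A : 'M[R]_n.+1) : (p + q = n.+1)%N ->
  A \in unitmx -> hsig p q (A *m diag_mx (sig_std R n.+1 p) *m A^T).
Proof.
move=> pq uA; set D := diag_mx _.
have sM : (A *m D *m A^T)^T = A *m D *m A^T by rewrite !trmx_mul trmxK tr_diag_mx mulmxA.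
split=> //; have [U [d [UU Ud]]] := sym_orthodiag sM.
exists U, d; do 2!split=> //.
have uU : U^T \in unitmx by rewrite unitmx_tr; have [] := mulmx1_unit UU.
have E : (U^T *m A) *m D *m (U^T *m A)^T = diag_mx d.
  by rewrite -Ud trmx_mul trmxK !mulmxA.
have f : row_free (U^T *m A) by rewrite row_free_unit unitmx_mul uU.
have [cp cq] := card_sig_std R pq.
have := card_nonneg_le f E; have := card_nonpos_le f E; rewrite cp cq.
have [] := card_sign d.
have : (#|[set i | (0 < d 0 i)%R]| <= #|[set i | (0 <= d 0 i)%R]|)%N.
  by apply/subset_leq_card/fintype.subsetP => i; rewrite !inE => /ltW.
have : (#|[set i | (d 0 i < 0)%R]| <= #|[set i | (d 0 i <= 0)%R]|)%N.
  by apply/subset_leq_card/fintype.subsetP => i; rewrite !inE => /ltW.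
move: #|[set i | 0 < _]| #|[set i | 0 <= _]| #|[set i | _ < 0]| #|[set i | _ <= 0]|.
by move=> a b c e; lia.
Qed.

Lemma hsig_to_std (R : rcfType) n p q (M : 'M[R]_n.+1) : (p + q = n.+1)%N ->
  hsig p q M -> exists2 A, A \in unitmx & A *m M *m A^T = diag_mx (sig_std R n.+1 p).
Proof.
move=> pq [sM [U [d [UU [Ud [dp dq]]]]]].
(* Positive indices come before negative ones, to match the order of [sig_std]. *)
pose s := enum [set i | 0 < d 0 i] ++ enum [set i | d 0 i < 0].
have ss : size s = n.+1 by rewrite size_cat -!cardE dp dq.
have us : uniq s.
  rewrite cat_uniq !enum_uniq andbT /=; apply/hasPn => i; rewrite !mem_enum !inE.
  by move=> di; rewrite -leNgt ltW.
pose f (i : 'I_n.+1) := nth ord0 s i.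
have fi : injective f.
  by move=> i j /eqP; rewrite nth_uniq ?ss // => /eqP /val_inj.
have fd (i : 'I_n.+1) : if (i < p)%N then 0 < d 0 (f i) else d 0 (f i) < 0.
  rewrite /f nth_cat -cardE dp; case: ifP => ip.
    have : nth ord0 (enum [set i | 0 < d 0 i]) i \in [set i | 0 < d 0 i].
      by rewrite -mem_enum mem_nth // -cardE dp.
    by rewrite inE ip.
  have : nth ord0 (enum [set i | d 0 i < 0]) (i - p) \in [set i | d 0 i < 0].
    by rewrite -mem_enum mem_nth // -cardE dq ltn_subLR ?pq // leqNgt ip.
  by rewrite inE ip.
pose B : 'M[R]_n.+1 := \matrix_(i, j) ((Num.sqrt `|d 0 (f i)|)^-1 * (j == f i)%:R).
have BE : B *m diag_mx d *m B^T = diag_mx (sig_std R n.+1 p).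
  rewrite mul_mx_diag; apply/matrixP => i k; rewrite !mxE.
  rewrite (bigD1 (f i)) //= big1 ?addr0 => [|j /negbTE ji]; last first.
    by rewrite !mxE ji mulr0 !mul0r.
  rewrite !mxE eqxx (inj_eq fi); case: (eqVneq i k) => [<-|_]; last by rewrite !mulr0.
  have d0 : d 0 (f i) != 0.
    by have := fd i; case: ifP => _ h; [rewrite gt_eqF | rewrite lt_eqF].
  rewrite !mulr1 mulr1n mulrAC -invfM -expr2 sqr_sqrtr ?normr_ge0 //.
  have := fd i; case: ifP => _ h; first by rewrite gtr0_norm // mulVf.
  by rewrite ltr0_norm // invrN mulNr mulVf.
exists (B *m U^T); last first.
  by rewrite trmx_mul trmxK -BE -Ud !mulmxA.
have : B *m diag_mx d *m B^T \in unitmx by rewrite BE sig_std_unit.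
rewrite !unitmx_mul => /andP [/andP [-> _] _] /=.
by rewrite unitmx_tr; have [] := mulmx1_unit UU.
Qed.

Lemma hsig_congr (R : rcfType) n p q (M A : 'M[R]_n.+1) : (p + q = n.+1)%N ->
  A \in unitmx -> hsig p q M -> hsig p q (A *m M *m A^T).
Proof.
move=> pq uA /(hsig_to_std pq) [B uB BM].
have -> : M = invmx B *m diag_mx (sig_std R n.+1 p) *m (invmx B)^T.
  by rewrite -BM !mulmxA mulVmx // mul1mx -mulmxA -trmx_mul mulVmx // trmx1 mulmx1.
have -> : A *m (invmx B *m diag_mx (sig_std R n.+1 p) *m (invmx B)^T) *m A^T =
    (A *m invmx B) *m diag_mx (sig_std R n.+1 p) *m (A *m invmx B)^T.
  by rewrite trmx_mul !mulmxA.
by apply: hsig_of_std => //; rewrite unitmx_mul uA unitmx_inv.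
Qed.

Lemma hsig_unit (R : rcfType) n p q (M : 'M[R]_n.+1) : (p + q = n.+1)%N ->
  hsig p q M -> M \in unitmx.
Proof.
move=> pq /(hsig_to_std pq) [A uA E].
have := sig_std_unit R n.+1 p; rewrite -E !unitmx_mul; by move=> /andP [/andP []].
Qed.

(** Equal signatures make the two forms congruent through some [h]; moving [F1] by [h] reduces the
    claim to Witt's theorem for [M2] alone. *)
Lemma witt_ext2 (R : rcfType) k n p q (M1 M2 : 'M[R]_n.+1) (F1 F2 : 'M[R]_(k, n.+1)) :
  (p + q = n.+1)%N -> hsig p q M1 -> hsig p q M2 -> row_free F1 -> row_free F2 ->
  F1 *m M1 *m F1^T = F2 *m M2 *m F2^T ->
  exists g : 'M[R]_n.+1, [/\ g \in unitmx, g *m M2 *m g^T = M1 & F1 *m g = F2].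
Proof.
move=> pq s1 s2 f1 f2 E.
have [A1 u1 E1] := hsig_to_std pq s1; have [A2 u2 E2] := hsig_to_std pq s2.
pose h := invmx A1 *m A2.
have uh : h \in unitmx by rewrite unitmx_mul unitmx_inv u1.
have hM : h *m M2 *m h^T = M1.
  rewrite /h trmx_mul !mulmxA -(mulmxA _ A2) -(mulmxA _ (A2 *m M2)) E2 -E1.
  by rewrite !mulmxA mulVmx // mul1mx -mulmxA -trmx_mul mulVmx // trmx1 mulmx1.
have fh : row_free (F1 *m h) by rewrite /row_free mxrankMfree // row_free_unit.
have EE : F1 *m h *m M2 *m (F1 *m h)^T = F2 *m M2 *m F2^T.
  by rewrite -E -hM trmx_mul !mulmxA.
have [g [gM Fg]] := witt_ext (proj1 s2) (hsig_unit pq s2) fh f2 EE.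
have gM1 : (h *m g) *m M2 *m (h *m g)^T = M1.
  by rewrite trmx_mul !mulmxA -(mulmxA h) -(mulmxA h) gM.
exists (h *m g); split=> //; last by rewrite mulmxA.
have := hsig_unit pq s1; rewrite -gM1 !unitmx_mul; by move=> /andP [/andP []].
Qed.

(** * Frames adapted to a flag *)

(* The center [Z] of the Lie algebra is the kernel of [x |-> x *m Emx]; [e2] spans [h_3, h_3]. *)
Definition Emx (R : rcfType) n : 'M[R]_(n.+1, 2) := \matrix_(i, j) (i == j :> nat)%:R.
Definition e2 (R : rcfType) n : 'rV[R]_n.+1 := delta_mx 0 (inord 2).

(* Types are sequences of codes 0, 1, 2 standing for the signs -1, 0, 1. *)
Definition tvec (R : rcfType) (t : seq nat) : 'rV[R]_(size t) := \row_i ((nth 0 t i)%:R - 1).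

(* [Smx *m F] is the first row of [F] and [Pmx *m F] consists of its last two rows. *)
Definition Smx (R : rcfType) k : 'rV[R]_k := \row_j (j == 0 :> nat)%:R.
Definition Pmx (R : rcfType) k : 'M[R]_(2, k) := \matrix_(i, j) (j == i + (k - 2) :> nat)%N%:R.

(* [A] and [Q] preserve the flag; no relation between [mu] and [\det Q] is imposed because a
   homothety, absorbed by the scaling of metrics, restores [mu = \det Q]. *)
Definition flag_equiv (R : rcfType) n (M1 M2 : 'M[R]_n.+1) : Prop :=
  exists (A : 'M[R]_n.+1) (Q : 'M[R]_2) (mu : R),
    [/\ A \in unitmx, A *m M2 *m A^T = M1, e2 R n *m A = mu *: e2 R n &
        A *m Emx R n = Emx R n *m Q].

(* The last two rows of [F] span the orthogonal [U] of [Z] and the first one spans the line [L];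
   when [size t = 2] the first row is also one of the two spanning [U]. *)
Definition frame (R : rcfType) n (t : seq nat) (M : 'M[R]_n.+1) : Prop :=
  exists (F : 'M[R]_(size t, n.+1)) (Q : 'M[R]_2) (mu : R),
    [/\ row_free F, Smx R _ *m F = mu *: e2 R n, Pmx R _ *m F *m M = Q *m (Emx R n)^T &
        F *m M *m F^T = diag_mx (tvec R t)].

Lemma Emx_trK (R : rcfType) n : (1 <= n)%N -> (Emx R n)^T *m Emx R n = 1%:M.
Proof.
move=> n1; apply/matrixP => i j; rewrite !mxE.
have iN : (i < n.+1)%N by apply: leq_trans (ltn_ord i) _.
rewrite (bigD1 (Ordinal iN)) //= big1 ?addr0 => [|k /negbTE ki].
  by rewrite !mxE eqxx mul1r.
by rewrite !mxE -[(k == i :> nat)]/(val k == val (Ordinal iN)) val_eqE ki mul0r.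
Qed.

Lemma Emx_free (R : rcfType) n : (1 <= n)%N -> row_free (Emx R n)^T.
Proof. by move=> n1; apply/row_freeP; exists (Emx R n); exact: Emx_trK. Qed.

Lemma mul_Emx (R : rcfType) n (x : 'rV[R]_n.+1) (j : 'I_2) : (1 <= n)%N ->
  (x *m Emx R n) 0 j = x 0 (inord j).
Proof.
move=> n1; have jN : (j < n.+1)%N by apply: leq_trans (ltn_ord j) _.
rewrite mxE (bigD1 (inord j)) //= big1 ?addr0 => [|k /negbTE ki].
  by rewrite mxE inordK // eqxx mulr1.
rewrite mxE -[X in k == X :> nat](inordK jN).
by rewrite -[(_ == _ :> nat)]/(val k == val (inord j)) val_eqE ki mulr0.
Qed.

Lemma e2_Emx (R : rcfType) n : (2 <= n)%N -> e2 R n *m Emx R n = 0.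
Proof.
move=> n2; apply/rowP => j; rewrite mul_Emx ?(ltnW n2) // !mxE.
have j2 : (j < 2)%N := ltn_ord j.
rewrite eqxx /=; case: eqP => // /(congr1 val) /=; rewrite !inordK //; last by lia.
by move=> jE; rewrite jE ltnn in j2.
Qed.

Lemma e2_neq0 (R : rcfType) n : e2 R n != 0.
Proof.
apply/eqP => /rowP /(_ (inord 2)); rewrite !mxE !eqxx => /eqP.
by rewrite oner_eq0.
Qed.

Lemma Emx_intertwiner_unit (R : rcfType) n (A : 'M[R]_n.+1) Q : (1 <= n)%N ->
  A \in unitmx -> A *m Emx R n = Emx R n *m Q -> Q \in unitmx.
Proof.
move=> n1 uA AE; have : ((Emx R n)^T *m invmx A *m Emx R n) *m Q = 1%:M.
  by rewrite -[in LHS]mulmxA -AE mulmxA mulmxKV // Emx_trK.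
by move/mulmx1_unit => [].
Qed.

Lemma Pmx_trK (R : rcfType) k : (2 <= k)%N -> Pmx R k *m (Pmx R k)^T = 1%:M.
Proof.
move=> k2; apply/matrixP => i j; rewrite !mxE.
have iN : (i + (k - 2) < k)%N by have := ltn_ord i; lia.
rewrite (bigD1 (Ordinal iN)) //= big1 ?addr0 => [|l /negbTE li].
  by rewrite !mxE eqxx mul1r eqn_add2r.
by rewrite !mxE -[(l == _ :> nat)]/(val l == val (Ordinal iN)) val_eqE li mul0r.
Qed.

Lemma Pmx_free (R : rcfType) k : (2 <= k)%N -> row_free (Pmx R k).
Proof. by move=> k2; apply/row_freeP; exists (Pmx R k)^T; exact: Pmx_trK. Qed.

Lemma row_free_mul (R : fieldType) m n p (A : 'M[R]_(m, n)) (B : 'M[R]_(n, p)) :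
  row_free A -> row_free B -> row_free (A *m B).
Proof. by move=> fA fB; rewrite /row_free mxrankMfree. Qed.

Lemma frame_Q_unit (R : rcfType) n k (M : 'M[R]_n.+1) (F : 'M[R]_(k, n.+1)) Q :
  (2 <= k)%N -> M \in unitmx -> row_free F ->
  Pmx R k *m F *m M = Q *m (Emx R n)^T -> Q \in unitmx.
Proof.
move=> k2 uM fF E; rewrite -row_free_unit -row_leq_rank.
have : row_free (Q *m (Emx R n)^T).
  by rewrite -E !row_free_mul ?Pmx_free // row_free_unit.
by rewrite -row_leq_rank => h; apply: leq_trans h (mxrankM_maxl _ _).
Qed.

Lemma Smx_mul_neq0 (R : rcfType) n k (F : 'M[R]_(k, n)) : (0 < k)%N ->
  row_free F -> Smx R k *m F != 0.
Proof.
move=> k0 fF; apply/eqP => /(mul_row_free_eq0 fF) /rowP /(_ (Ordinal k0)).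
by rewrite !mxE /= => /eqP; rewrite oner_eq0.
Qed.

(** Equal Gram matrices give, by Witt, a [g] carrying [F1] to [F2]. It respects the line through the
    first rows; it respects the center because it respects the orthogonal of the center, spanned by
    the last two rows, and the witness for [Q] comes from transposing that relation. *)
Lemma flag_equiv_of_frame (R : rcfType) n p q t (M1 M2 : 'M[R]_n.+1) :
  (p + q = n.+1)%N -> (2 <= n)%N -> (2 <= size t)%N -> hsig p q M1 -> hsig p q M2 ->
  frame t M1 -> frame t M2 -> flag_equiv M1 M2.
Proof.
move=> pq n2 t2 s1 s2 [F1 [Q1 [m1 [f1 S1 P1 G1]]]] [F2 [Q2 [m2 [f2 S2 P2 G2]]]].
have [g [ug gM Fg]] := witt_ext2 pq s1 s2 f1 f2 (etrans G1 (esym G2)).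
have uQ2 := frame_Q_unit t2 (hsig_unit pq s2) f2 P2.
have m10 : m1 != 0.
  have := Smx_mul_neq0 (ltnW t2) f1; rewrite S1; apply: contra_neq => ->.
  by rewrite scale0r.
exists g, (Q1^T *m invmx Q2^T), (m1^-1 * m2); split=> //.
  by rewrite -scalerA -S2 -Fg mulmxA S1 -scalemxAl scalerA mulVf // scale1r.
have uQ2t : Q2^T \in unitmx by rewrite unitmx_tr.
apply: (can_inj (mulmxK uQ2t)); rewrite !mulmxA mulmxKV //.
apply: trmx_inj; rewrite !trmx_mul !trmxK mulmxA -P2 -P1 -Fg -gM.
by rewrite !mulmxA.
Qed.

Lemma frame_flag_equiv (R : rcfType) n t (M1 M2 : 'M[R]_n.+1) : (2 <= n)%N ->
  flag_equiv M1 M2 -> frame t M1 -> frame t M2.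
Proof.
move=> n2 [A [Q [mu [uA AM Ae AE]]]] [F [Q1 [m [f S P G]]]].
have uQ := Emx_intertwiner_unit (ltnW n2) uA AE.
have uAt : A^T \in unitmx by rewrite unitmx_tr.
exists (F *m A), (Q1 *m invmx Q^T), (m * mu); split.
- by rewrite row_free_mul // row_free_unit.
- by rewrite mulmxA S -scalemxAl Ae scalerA.
- apply: (can_inj (mulmxK uAt)).
  rewrite -[RHS]mulmxA -trmx_mul AE trmx_mul.
  rewrite !mulmxA (mulmxKV (_ : Q^T \in unitmx)) ?unitmx_tr // -P -AM.
  by rewrite !mulmxA.
- by rewrite -G -AM trmx_mul !mulmxA.
Qed.

(* [:: l; b; c] with [c <= b]: [L] is not contained in [U], has sign [l], and [U] is diag(b, c).
   [:: 1; b]: [L] lies in [U], hence in its radical, and [b] is the other diagonal entry. *)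
Definition types : seq (seq nat) :=
  [seq [:: a; bc.1; bc.2] | a <- [:: 0; 1; 2],
     bc <- [:: (0, 0); (1, 0); (1, 1); (2, 0); (2, 1); (2, 2)]] ++
  [seq [:: 1; b] | b <- [:: 0; 1; 2]]%N.

Definition last2 (t : seq nat) := mkseq (fun i => nth 0 t (i + (size t - 2)))%N 2.

(** Codes at least 1 are the signs 0 and 1, codes at most 1 the signs -1 and 0, so the two counts
    are the inertia of [U], null vectors being counted twice. *)
Definition tkey (t : seq nat) :=
  (size t, head 0 t, count (leq 1) (last2 t), count (geq 1) (last2 t))%N.

Lemma tkey_inj : {in types &, injective tkey}.
Proof.
have : all (fun t => all (fun u => (tkey t == tkey u) ==> (t == u)) types) types by vm_compute.
move=> /allP h t u ht hu /eqP tu; apply/eqP.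
by have /allP /(_ u hu) := h t ht; rewrite tu.
Qed.

Lemma types_prop t : t \in types ->
  [/\ (size t == 2) || (size t == 3), all (geq 2) t & (size t == 2) ==> (head 0 t == 1)]%N.
Proof.
have : all (fun t => [&& (size t == 2) || (size t == 3), all (geq 2) t
  & (size t == 2) ==> (head 0 t == 1)])%N types by vm_compute.
by move=> /allP h /h /and3P.
Qed.

Lemma types_size t : t \in types -> (2 <= size t)%N.
Proof. by move=> /types_prop [] /orP [/eqP ->|/eqP ->]. Qed.

Lemma count_mkseq T (a : pred T) f k : count a (mkseq f k) = #|[set i : 'I_k | a (f i)]|.
Proof.
rewrite /mkseq count_map -val_enum_ord count_map cardE [in RHS]/enum_mem size_filter -enumT.
by apply: eq_count => i; rewrite /= inE.
Qed.

Lemma count_card (a : pred nat) t : count a t = #|[set i : 'I_(size t) | a (nth 0%N t i)]|.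
Proof. by rewrite -[in LHS](mkseq_nth 0%N t) count_mkseq. Qed.

Lemma natr_sub1_ge0 (R : realDomainType) m : (0 <= m%:R - 1 :> R) = (1 <= m)%N.
Proof. by rewrite subr_ge0 -(ler_nat R). Qed.

Lemma natr_sub1_le0 (R : realDomainType) m : (m%:R - 1 <= 0 :> R) = (m <= 1)%N.
Proof. by rewrite subr_le0 -(ler_nat R). Qed.

Lemma sgr_natr_sub1_inj (R : realFieldType) a b : (a <= 2)%N -> (b <= 2)%N ->
  Num.sg (a%:R - 1 : R) = Num.sg (b%:R - 1) -> a = b.
Proof.
have sg0 : Num.sg (0%:R - 1 : R) = -1 by rewrite sub0r sgrN sgr1.
have sg1 : Num.sg (1%:R - 1 : R) = 0 by rewrite subrr sgr0.
have sg2 : Num.sg (2%:R - 1 : R) = 1 by rewrite (_ : 2%:R - 1 = 1 :> R) ?sgr1 //; ring.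
have N11 : (-1 : R) <> 1 by move=> ?; lra.
have N10 : (-1 : R) <> 0 by move=> ?; lra.
have N01 : (0 : R) <> 1 by move=> ?; lra.
case: a => [|[|[|]]] // _; case: b => [|[|[|]]] // _; rewrite ?sg0 ?sg1 ?sg2 => h //;
  exfalso; move: h; try exact; by move/esym.
Qed.

Definition tvec2 (R : rcfType) t : 'rV[R]_2 :=
  \row_i ((nth 0 t (i + (size t - 2)))%N%:R - 1).

Lemma Pmx_tvec (R : rcfType) t : (2 <= size t)%N ->
  Pmx R (size t) *m diag_mx (tvec R t) *m (Pmx R (size t))^T = diag_mx (tvec2 R t).
Proof.
move=> t2; apply/matrixP => i j; rewrite mul_mx_diag !mxE.
have ik : (i + (size t - 2) < size t)%N by have := ltn_ord i; lia.
rewrite (bigD1 (Ordinal ik)) //= big1 ?addr0 => [|l /negbTE li].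
  rewrite !mxE eqxx mul1r eqn_add2r -[(i == j :> nat)]/(i == j).
  by case: eqP; rewrite ?mulr1 ?mulr0.
by rewrite !mxE -[(l == _ :> nat)]/(val l == val (Ordinal ik)) val_eqE li !mul0r.
Qed.

(** Each component of [tkey] depends on [M] and the flag alone: the size tells whether [e2] is in
    the orthogonal of the center, the head is the sign of the norm of [e2], and the counts are the
    inertia on that orthogonal, the same in any two bases. *)
Lemma frame_uniq (R : rcfType) n p q t u (M : 'M[R]_n.+1) :
  (p + q = n.+1)%N -> hsig p q M ->
  t \in types -> u \in types -> frame t M -> frame u M -> t = u.
Proof.
move=> pq sM tT uT ft fu; apply: tkey_inj => //.
have uM := hsig_unit pq sM.
(* The last two rows of every frame span the same plane. A frame of size 2 puts [e2] in it; a frame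
   of size 3 has a multiple of [e2] as first row, independent of the last two. *)
have sizeP v w : v \in types -> w \in types -> frame v M -> frame w M ->
    size v == 2 -> size w == 3 -> False.
  move=> vT wT [F [Q [m [fF SF PF _]]]] [F' [Q' [m' [fF' SF' PF' _]]]] v2 w3.
  have uQ' := frame_Q_unit (types_size wT) uM fF' PF'.
  have SP : Smx R (size v) = delta_mx 0 0 *m Pmx R (size v).
    apply/rowP => j; by rewrite -rowE !mxE; congr (_ == _)%:R; move/eqP: v2 => ->.
  have m0 : m != 0.
    have := Smx_mul_neq0 (ltnW (types_size vT)) fF; rewrite SF; apply: contra_neq => ->.
    by rewrite scale0r.
  have eM : e2 R n *m M = m^-1 *: (delta_mx 0 0 *m Q) *m (Emx R n)^T.
    have SM : Smx R _ *m F *m M = delta_mx 0 0 *m Q *m (Emx R n)^T.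
      by rewrite SP -[RHS]mulmxA -PF !mulmxA.
    by rewrite -scalemxAl -SM SF -scalemxAl scalerA mulVf // scale1r.
  have EP : (Emx R n)^T = invmx Q' *m (Pmx R _ *m F') *m M.
    by rewrite -mulmxA PF' mulKmx.
  move: eM; rewrite EP !mulmxA => /(can_inj (mulmxK uM)) eF.
  move: SF'; rewrite eF scalemxAl => /(row_free_inj fF') /rowP.
  have w0 : (0 < size w)%N by rewrite (eqP w3).
  move=> /(_ (Ordinal w0)); rewrite -scalemxAl !mxE /= big1 ?mulr0; last first.
    move=> i _; rewrite [Pmx _ _ _ _]mxE /= -[(_ == _)%N]/(0 == i + (size w - 2))%N.
    by move/eqP: w3 => ->; rewrite addn1 mulr0.
  by move=> /eqP; rewrite oner_eq0.
have sz : size t = size u.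
  have [/orP [] t2 _ _] := types_prop tT; have [/orP [] u2 _ _] := types_prop uT.
  - by rewrite (eqP t2) (eqP u2).
  - by have [] := sizeP t u tT uT ft fu t2 u2.
  - by have [] := sizeP u t uT tT fu ft u2 t2.
  - by rewrite (eqP t2) (eqP u2).
rewrite /tkey sz.
move: ft fu => [F [Q [m [fF SF PF GF]]]] [F' [Q' [m' [fF' SF' PF' GF']]]].
have uQ := frame_Q_unit (types_size tT) uM fF PF.
have uQ' := frame_Q_unit (types_size uT) uM fF' PF'.
have headP v (K : 'M[R]_(size v, n.+1)) (l : R) : v \in types -> row_free K ->
    Smx R _ *m K = l *: e2 R n -> K *m M *m K^T = diag_mx (tvec R v) ->
    Num.sg ((head 0%N v)%:R - 1) = Num.sg (bil M (e2 R n) (e2 R n)).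
  move=> vT fK SK GK; have v0 := ltnW (types_size vT).
  have -> : (head 0%N v)%:R - 1 = bil (diag_mx (tvec R v)) (Smx R _) (Smx R _).
    rewrite bil_diag (bigD1 (Ordinal v0)) //= big1 ?addr0 => [|j j0].
      by rewrite !mxE /= !mulr1 nth0.
    rewrite !mxE; case: eqP => [h|]; last by rewrite !mulr0.
    by move: j0; rewrite -val_eqE /= h.
  rewrite -GK bil_mul SK bilZl bilZr mulrA sgrM -expr2 gtr0_sg ?mul1r //.
  rewrite lt_neqAle sqr_ge0 andbT eq_sym sqrf_eq0.
  have := Smx_mul_neq0 v0 fK; rewrite SK; apply: contra_neq => ->.
  by rewrite scale0r.
have hh : head 0%N t = head 0%N u.
  have := headP _ _ _ tT fF SF GF; rewrite -(headP _ _ _ uT fF' SF' GF').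
  have [_ + _] := types_prop tT; have [_ + _] := types_prop uT.
  case: (t) tT => [|a s] // _; case: (u) uT => [|b s'] // _ /=.
  move=> /andP [b2 _] /andP [a2 _].
  exact: sgr_natr_sub1_inj.
have PFE : Pmx R _ *m F = (Q *m invmx Q') *m (Pmx R _ *m F').
  by apply: (can_inj (mulmxK uM)); rewrite PF -[RHS]mulmxA PF' mulmxA mulmxKV.
have fT : row_free (Q *m invmx Q') by rewrite row_free_unit unitmx_mul uQ unitmx_inv.
move: (Q *m invmx Q') PFE fT => T PFE fT.
have key2 : T *m diag_mx (tvec2 R u) *m T^T = diag_mx (tvec2 R t).
  rewrite -!Pmx_tvec ?types_size // -GF -GF'.
  transitivity ((Pmx R _ *m F) *m M *m (Pmx R _ *m F)^T); last by rewrite trmx_mul !mulmxA.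
  by rewrite PFE !trmx_mul !mulmxA.
have key2' : invmx T *m diag_mx (tvec2 R t) *m (invmx T)^T
    = diag_mx (tvec2 R u).
  rewrite row_free_unit in fT.
  by rewrite -key2 !mulmxA mulVmx // mul1mx -mulmxA -trmx_mul mulVmx // trmx1 mulmx1.
have fT' : row_free (invmx T) by rewrite row_free_unit unitmx_inv -row_free_unit.
have cnt v : count (leq 1) (last2 v) = #|[set i | (0 <= (tvec2 R v) 0 i)%R]| /\
             count (geq 1) (last2 v) = #|[set i | ((tvec2 R v) 0 i <= 0)%R]|.
  rewrite !count_mkseq; split; apply: eq_card => i; rewrite !inE mxE.
    by rewrite natr_sub1_ge0.
  by rewrite natr_sub1_le0.
have [-> ->] := cnt t; have [-> ->] := cnt u.
rewrite hh; congr (_, _, _, _); apply/eqP; rewrite eqn_leq.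
  by rewrite (card_nonneg_le fT key2) (card_nonneg_le fT' key2').
by rewrite (card_nonpos_le fT key2) (card_nonpos_le fT' key2').
Qed.

Lemma sign_scale (R : rcfType) (m : R) :
  exists mu c, [/\ mu != 0, (c <= 2)%N & mu * (mu * m) = c%:R - 1].
Proof.
have [->|m0] := eqVneq m 0.
  by exists 1, 1%N; rewrite oner_neq0 !mulr0 subrr.
have n0 : `|m| != 0 by rewrite normr_eq0.
have sq : (Num.sqrt `|m|)^-1 * ((Num.sqrt `|m|)^-1 * m) = Num.sg m.
  rewrite mulrA -invfM -expr2 sqr_sqrtr ?normr_ge0 //.
  by rewrite {2}[m]numEsg mulrCA mulVf ?mulr1.
have s0 : (Num.sqrt `|m|)^-1 != 0 by rewrite invr_eq0 sqrtr_eq0 -ltNge normr_gt0.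
have [h|h|h] := ltrgt0P m; last by rewrite h eqxx in m0.
  by exists (Num.sqrt `|m|)^-1, 2%N; split=> //; rewrite sq gtr0_sg //; ring.
by exists (Num.sqrt `|m|)^-1, 0%N; split=> //; rewrite sq ltr0_sg //; ring.
Qed.

Lemma sgnv_nat (R : realFieldType) k (e : 'rV[R]_k) i : sgnv e ->
  exists2 c, (c <= 2)%N & e 0 i = c%:R - 1.
Proof.
move=> /(_ i) [->|[->|->]]; [exists 2%N|exists 1%N|exists 0%N] => //; ring.
Qed.

Lemma sym2_signdiag (R : rcfType) (M : 'M[R]_2) : M^T = M ->
  exists (T : 'M[R]_2) b c, [/\ T \in unitmx, (c <= b <= 2)%N &
    T *m M *m T^T = diag_mx (\row_i ((nth 0 [:: b; c] i)%N%:R - 1))].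
Proof.
move=> sM; have [T [e [uT TM es]]] := sym_signdiag sM.
have [b b2 eb] := sgnv_nat 0 es; have [c c2 ec] := sgnv_nat 1 es.
have [cb|bc] := leqP c b.
  exists T, b, c; rewrite cb b2 TM; split=> //; congr diag_mx.
  apply/rowP => i; rewrite mxE.
  by case: i => [[|[|i]] hi] //=; rewrite -?eb -?ec; congr (e _ _); apply: val_inj.
(* Exchanging the two rows puts the larger code first, since [types] lists each unordered pair
   once. *)
exists (row_perm (tperm 0 1) T), c, b; rewrite (ltnW bc) c2; split=> //.
  by rewrite row_permE unitmx_mul unitmx_perm.
apply/matrixP => i j; rewrite -bil_row.
have rp k : row k (row_perm (tperm 0 1) T) = row (tperm 0 1 k) T.
  by apply/rowP => l; rewrite !mxE.
rewrite !rp bil_row TM !mxE (inj_eq perm_inj).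
case: (eqVneq i j) => [_|//]; rewrite !mulr1n.
case: i => [[|[|i]] hi] //=.
  by rewrite -ec; congr (e _ _); rewrite (_ : Ordinal hi = 0) ?tpermL //; apply: val_inj.
by rewrite -eb; congr (e _ _); rewrite (_ : Ordinal hi = 1) ?tpermR //; apply: val_inj.
Qed.

Lemma types_mem3 a b c : (a <= 2)%N -> (c <= b <= 2)%N -> [:: a; b; c] \in types.
Proof.
by case: a => [|[|[|]]] // _ /andP []; case: b => [|[|[|]]] //; case: c => [|[|[|]]].
Qed.

Lemma types_mem2 c : (c <= 2)%N -> [:: 1%N; c] \in types.
Proof. by case: c => [|[|[|]]]. Qed.

(** [e2] is central, hence orthogonal to [U]. Outside [U], only its norm and the form on [U] remain
    to be normalized. Inside [U], it is null and orthogonal to any vector completing it to a basis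
    of [U], whose norm alone needs scaling. *)
Lemma frame_exists (R : rcfType) n (M : 'M[R]_n.+1) : (2 <= n)%N ->
  M^T = M -> M \in unitmx -> exists2 t, t \in types & frame t M.
Proof.
(* The products of [x] with the rows of [U] are the entries of [x *m Emx R n], so [U] spans the
   orthogonal of the center. *)
move=> n2 sM uM; pose U := (Emx R n)^T *m invmx M.
have UM : U *m M = (Emx R n)^T by rewrite mulmxKV.
have MU : M *m U^T = Emx R n.
  by apply: trmx_inj; rewrite trmx_mul trmxK sM UM.
have fU : row_free U.
  rewrite /U row_free_mul //; first by apply: Emx_free; exact: ltnW.
  by rewrite row_free_unit unitmx_inv.
clearbody U.
have eU : e2 R n *m M *m U^T = 0 by rewrite -mulmxA MU e2_Emx.
have sU : (U *m M *m U^T)^T = U *m M *m U^T by rewrite !trmx_mul trmxK sM mulmxA.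
have [/submxP [x ex]|eN] := boolP (e2 R n <= U)%MS.
  have x0 : x != 0 by apply: contra_neq (e2_neq0 R n) => h; rewrite ex h mul0mx.
  (* A quarter turn of [x]: nonzero and Euclidean-orthogonal to [x], hence independent of it. *)
  pose y : 'rV[R]_2 := \row_i (if i == 0 then - x 0 1 else x 0 0).
  have yx : y *m x^T = 0.
    apply/matrixP => i j; rewrite !ord1 !mxE !big_ord_recl big_ord0 !mxE /=.
    rewrite (_ : lift ord0 ord0 = 1); last exact: val_inj.
    by rewrite addr0 mulNr [X in _ + X]mulrC addNr.
  have y0 : y != 0.
    apply: contra_neq x0 => h; apply/rowP => i.
    have := congr1 (fun v : 'rV[R]_2 => v 0 0) h; have := congr1 (fun v : 'rV[R]_2 => v 0 1) h.
    rewrite !mxE /= => h0 /eqP; rewrite oppr_eq0 => /eqP h1.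
    case: i => [[|[|i]] hi] //; [rewrite -[RHS]h0|rewrite -[RHS]h1];
      congr (x _ _); exact: val_inj.
  have [nu [c [nu0 c2 nuc]]] := sign_scale (bil M (y *m U) (y *m U)).
  pose T : 'M[R]_(1 + 1, 2) := col_mx x (nu *: y).
  have fT : row_free T.
    apply: inj_row_free => v; rewrite -[v]hsubmxK mul_row_col.
    rewrite (mx11_scalar (lsubmx v)) (mx11_scalar (rsubmx v)) !mul_scalar_mx => h.
    have := congr1 (mulmx^~ x^T) h; rewrite mulmxDl -!scalemxAl yx !scaler0 addr0 mul0mx.
    move=> /(congr1 (fun X : 'M[R]_1 => X 0 0)); rewrite mxE [RHS]mxE => /eqP.
    have := bil1_gt0 x0; rewrite /bil mulmx1 mulf_eq0 => /gt_eqF -> /=; rewrite orbF => /eqP a0.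
    move: h; rewrite a0 scale0r add0r scalerA => /eqP; rewrite scaler_eq0 (negbTE y0) orbF.
    by rewrite mulf_eq0 (negbTE nu0) orbF => /eqP ->; rewrite !raddf0 row_mx0.
  exists [:: 1%N; c]; first exact: types_mem2.
  exists (T *m U), T, 1; split.
  - by rewrite row_free_mul.
  - rewrite scale1r ex mulmxA; congr (_ *m _).
    have SE : Smx R (1 + 1) = row_mx (1%:M : 'M[R]_1) (0 : 'M[R]_1).
      by apply/rowP => j; rewrite !mxE; case: splitP => k /= ->; rewrite !mxE ?ord1.
    transitivity (row_mx 1%:M 0 *m T); last by rewrite mul_row_col mul1mx mul0mx addr0.
    by rewrite -SE.
  - have PE : Pmx R 2 = 1%:M.
      by apply/matrixP => i j; rewrite !mxE subnn addn0 eq_sym.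
    transitivity ((1%:M : 'M[R]_2) *m (T *m U) *m M); last by rewrite mul1mx -UM mulmxA.
    by rewrite -PE.
  - have tE : tvec R [:: 1%N; c] = row_mx (0 : 'M[R]_1) ((c%:R - 1)%:M : 'M[R]_1) :> 'rV_(1 + 1).
      by apply/rowP => j; rewrite !mxE; case: splitP => k /= ->; rewrite !mxE ?ord1 //= subrr.
    have eM (z : 'rV[R]_2) : e2 R n *m M *m (z *m U)^T = 0.
      by rewrite trmx_mul mulmxA eU mul0mx.
    have Me (z : 'rV[R]_2) : z *m U *m M *m (e2 R n)^T = 0.
      by apply: trmx_inj; rewrite !trmx_mul trmxK sM mulmxA -trmx_mul eM trmx0.
    have ee : e2 R n *m M *m (e2 R n)^T = 0 by rewrite {2}ex eM.
    suff : (T *m U) *m M *m (T *m U)^T = diag_mx (row_mx (0 : 'M[R]_1) ((c%:R - 1)%:M : 'M[R]_1)).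
      by rewrite -tE.
    rewrite diag_mx_row /T mul_col_mx -ex tr_col_mx mul_col_mx mul_mx_row !mul_col_mx.
    rewrite -block_mxEh -[(nu *: y) *m U]scalemxAl [(_ *: _)^T]linearZ /= -!scalemxAl -!scalemxAr.
    rewrite ee eM Me !scaler0 bilE !scale_scalar_mx nuc.
    by congr block_mx; apply/matrixP => i j; rewrite !ord1 !mxE.
have [T [b [c [uT cb TM]]]] := sym2_signdiag sU.
have [mu [a [mu0 a2 mua]]] := sign_scale (bil M (e2 R n) (e2 R n)).
exists [:: a; b; c]; first exact: types_mem3.
pose F : 'M[R]_(1 + 2, n.+1) := col_mx (mu *: e2 R n) (T *m U).
have fF : row_free F.
  apply: inj_row_free => v; rewrite -[v](@hsubmxK _ _ 1 2) mul_row_col.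
  rewrite (mx11_scalar (lsubmx v)) mul_scalar_mx scalerA.
  set l := lsubmx v 0 0; set r := rsubmx v => h.
  have l0 : l * mu = 0.
    apply/eqP; apply: contraNT eN => lm0; apply/submxP; exists (- (l * mu)^-1 *: (r *m T)).
    apply: (can_inj (scalerK lm0)); rewrite -scalemxAl scalerA mulrN mulfV // scaleN1r.
    by apply/eqP; rewrite -addr_eq0 -mulmxA h.
  move: h; rewrite l0 scale0r add0r => /mul_row_free_eq0 -> //.
    by move/eqP: l0; rewrite mulf_eq0 (negbTE mu0) orbF => /eqP ->; rewrite raddf0 row_mx0.
  by apply: row_free_mul => //; rewrite row_free_unit.
exists F, T, mu; split=> //.
- have SE : Smx R (1 + 2) = row_mx (1%:M : 'M[R]_1) (0 : 'M[R]_(1, 2)).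
    by apply/rowP => j; rewrite !mxE; case: splitP => k /= ->; rewrite !mxE ?ord1.
  transitivity (row_mx 1%:M 0 *m F); last by rewrite mul_row_col mul1mx mul0mx addr0.
  by rewrite -SE.
- have PE : Pmx R (1 + 2) = row_mx (0 : 'M[R]_(2, 1)) (1%:M : 'M[R]_2).
    apply/matrixP => i j; rewrite !mxE; case: splitP => k /= ->; rewrite !mxE.
      by rewrite ord1 addn1.
    by rewrite (_ : (1 + 2 - 2 = 1)%N) // addnC eqn_add2r eq_sym.
  transitivity (row_mx 0 1%:M *m F *m M); first by rewrite -PE.
  by rewrite mul_row_col mul1mx mul0mx add0r -mulmxA UM.
have tE : tvec R [:: a; b; c] =
    row_mx ((a%:R - 1)%:M : 'M[R]_1) (\row_i ((nth 0 [:: b; c] i)%N%:R - 1)) :> 'rV_(1 + 2).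
  by apply/rowP => j; rewrite !mxE; case: splitP => k /= ->; rewrite !mxE ?ord1 //=.
suff : F *m M *m F^T = diag_mx (row_mx ((a%:R - 1)%:M : 'M[R]_1)
    (\row_(i < 2) ((nth 0 [:: b; c] i)%N%:R - 1))) by rewrite -tE.
have TUe : (T *m U) *m M *m (e2 R n)^T = 0.
  by rewrite -!mulmxA (mulmxA U) UM -trmx_mul e2_Emx // trmx0 mulmx0.
have eTU : e2 R n *m M *m (T *m U)^T = 0 by rewrite trmx_mul mulmxA eU mul0mx.
rewrite diag_mx_row /F tr_col_mx mul_col_mx mul_mx_row !mul_col_mx -block_mxEh.
rewrite -!scalemxAl [(_ *: _)^T]linearZ /= -!scalemxAr.
rewrite TUe eTU !scaler0 bilE !scale_scalar_mx mua -TM trmx_mul !mulmxA.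
by congr block_mx; apply/matrixP => i j; rewrite !ord1 !mxE.
Qed.

(** * Which types occur in a given signature *)

Lemma sum_delta (R : pzSemiRingType) n (a : 'I_n) (h : 'I_n -> R) :
  \sum_j (j == a)%:R * h j = h a.
Proof.
rewrite (bigD1 a) //= big1 ?addr0 => [|j /negbTE ->]; by rewrite ?mul0r ?eqxx ?mul1r.
Qed.

(* A null vector of the frame is the sum of a positive and a negative basis vector. *)
Lemma std_frame (R : rcfType) k n p (A B : {set 'I_k}) (f g : 'I_k -> 'I_n) :
  A :|: B = [set: 'I_k]%SET -> {in A &, injective f} -> {in B &, injective g} ->
  (forall i, i \in A -> (f i < p)%N) -> (forall i, i \in B -> (p <= g i)%N) ->
  exists2 F : 'M[R]_(k, n), row_free F &
    F *m diag_mx (sig_std R n p) *m F^T = diag_mx (\row_i ((i \in A)%:R - (i \in B)%:R)).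
Proof.
move=> AB fI gI fp gp.
pose F : 'M[R]_(k, n) := \matrix_(i, j) ((i \in A)%:R * (j == f i)%:R + (i \in B)%:R * (j == g i)%:R).
have fg i j : i \in A -> j \in B -> (f i == g j) = false.
  by move=> /fp iA /gp jB; apply/eqP => h; rewrite h ltnNge jB in iA.
have Ff i l : i \in A -> F l (f i) = ((l \in A) && (i == l))%:R.
  move=> iA; rewrite mxE; have [lA|lA] := boolP (l \in A).
    have [lB|lB] := boolP (l \in B); rewrite ?(fg _ _ iA lB) ?mulr0 ?mul0r addr0 mul1r /=;
      by rewrite (inj_in_eq fI).
  have [lB|lB] := boolP (l \in B); rewrite ?(fg _ _ iA lB) ?mulr0 ?mul0r addr0 //.
have Fg i l : i \in B -> F l (g i) = ((l \in B) && (i == l))%:R.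
  move=> iB; rewrite mxE; have [lB|lB] := boolP (l \in B).
    have [lA|lA] := boolP (l \in A); rewrite 1?[g i == _]eq_sym ?(fg _ _ lA iB) ?mulr0 ?mul0r add0r mul1r /=;
      by rewrite ?[g l == _]eq_sym (inj_in_eq gI).
  have [lA|lA] := boolP (l \in A); rewrite 1?[g i == _]eq_sym ?(fg _ _ lA iB) ?mulr0 ?mul0r ?add0r //.
exists F.
  apply/row_freeP; exists (\matrix_(j, i) (j == if i \in A then f i else g i)%:R).
  apply/matrixP => l i; rewrite !mxE.
  under eq_bigr => j _ do rewrite mulrC mxE.
  rewrite sum_delta eq_sym; case: ifP => iA.
    by rewrite Ff //; case: eqP => [<-|_]; rewrite ?iA ?andbF.
  have iB : i \in B by move/finset.setP: AB => /(_ i); rewrite !inE iA.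
  by rewrite Fg //; case: eqP => [<-|_]; rewrite ?iB ?andbF.
apply/matrixP => i l; rewrite mul_mx_diag !mxE.
transitivity (\sum_j (((i \in A)%:R * ((j == f i)%:R * F l j)) - ((i \in B)%:R * ((j == g i)%:R * F l j)))).
  apply: eq_bigr => j _; rewrite [_^T _ _]mxE !mxE.
  set x := _ + _ : R; rewrite !mulrA -mulrBl; congr (_ * _).
  rewrite mulrDl -!mulrA; congr (_ + _).
    have [iA|] := boolP (i \in A); last by rewrite !mul0r.
    by case: eqP => [->|_]; rewrite ?fp //= ?mulr1 ?mul0r ?mulr0.
  have [iB|] := boolP (i \in B); last by rewrite !mul0r oppr0.
  by case: eqP => [->|_]; rewrite ?ltnNge ?gp //= ?mul0r ?mulr0 ?oppr0 // !mul1r.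
rewrite sumrB -!mulr_sumr !sum_delta.
have [iA|iA] := boolP (i \in A); have [iB|iB] := boolP (i \in B);
  rewrite ?mul0r ?mul1r ?(Ff _ _ iA) ?(Fg _ _ iB) ?sub0r ?subr0;
  by case: (eqVneq i l) => [h|_]; rewrite -?h ?andbF ?iA ?iB ?(negbTE iA) ?(negbTE iB) ?mulr1n ?mulr0n ?subrr ?oppr0.
Qed.

Lemma index_enum_ltn (T : finType) (A : {set T}) x : x \in A -> (index x (enum A) < #|A|)%N.
Proof. by move=> xA; rewrite cardE index_mem mem_enum. Qed.

Lemma index_enum_inj (T : finType) (A : {set T}) : {in A &, injective (index^~ (enum A))}.
Proof.
move=> x y xA yA h; rewrite -[x](@nth_index _ x _ (enum A)) ?mem_enum // h.
by rewrite nth_index // mem_enum.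
Qed.

(** Rows with code 1 belong to both [A] and [B] and use up one column of each sign. [f] numbers [A]
    within the first [p] columns and [g] numbers [B] within the last [q], which is where the two
    bounds enter. *)
Lemma std_frame_types (R : rcfType) n p q t : (p + q = n.+1)%N -> all (geq 2) t ->
  (count (leq 1) t <= p)%N -> (count (geq 1) t <= q)%N ->
  exists2 F : 'M[R]_(size t, n.+1), row_free F &
    F *m diag_mx (sig_std R n.+1 p) *m F^T = diag_mx (tvec R t).
Proof.
move=> pq t2; rewrite !count_card.
set A := [set i | _]; set B := [set i | _] => Ap Bq.
pose f (i : 'I_(size t)) : 'I_n.+1 := inord (index i (enum A)).
pose g (i : 'I_(size t)) : 'I_n.+1 := inord (p + index i (enum B)).
have fE i : i \in A -> f i = index i (enum A) :> nat.
  by move=> /index_enum_ltn h; rewrite inordK // -pq (leq_trans (leq_trans h Ap)) ?leq_addr.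
have gE i : i \in B -> g i = (p + index i (enum B))%N :> nat.
  by move=> /index_enum_ltn h; rewrite inordK // -pq ltn_add2l (leq_trans h Bq).
have [] := @std_frame R _ n.+1 p A B f g.
- by apply/finset.setP => i; rewrite !inE /=; lia.
- move=> i j iA jA /(congr1 val) /=; rewrite !fE //; exact: index_enum_inj.
- move=> i j iA jA /(congr1 val) /=; rewrite !gE // => /addnI; exact: index_enum_inj.
- by move=> i iA; rewrite fE //; apply: leq_trans (index_enum_ltn iA) _.
- by move=> i iB; rewrite gE // leq_addr.
move=> F fF FE; exists F => //; rewrite FE; congr diag_mx; apply/rowP => i.
rewrite !mxE !inE /=; have := all_nthP 0%N t2 i (ltn_ord i).
by case: (nth 0%N t i) => [|[|[|]]] // _; rewrite /= ?subr0 ?sub0r; ring.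
Qed.

(** The map sending [x] to [x + (x a) b], with [b = l - e2] and [e2 a = 1], sends [e2] to [l],
    changes nothing modulo the center since [b] is central, and is invertible because
    [1 + b a = l a] is nonzero. *)
Lemma transvect_to (R : rcfType) n (l : 'rV[R]_n.+1) : (2 <= n)%N ->
  l != 0 -> l *m Emx R n = 0 ->
  exists B : 'M[R]_n.+1, [/\ B \in unitmx, e2 R n *m B = l & B *m Emx R n = Emx R n].
Proof.
move=> n2 l0 lE.
have [a [ea la]] : exists a : 'cV[R]_n.+1, (e2 R n *m a) 0 0 = 1 /\ (l *m a) 0 0 != 0.
  have cE (x : 'rV[R]_n.+1) j : (x *m delta_mx j (0 : 'I_1)) 0 0 = x 0 j.
    by rewrite -colE mxE.
  have [l2|l2] := eqVneq (l 0 (inord 2)) 0; last first.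
    by exists (delta_mx (inord 2) 0); rewrite !cE !mxE !eqxx.
  have [j lj] : exists j, l 0 j != 0 by apply/rV0Pn.
  (* Here [l] has no [e2]-coordinate; a nonzero coordinate [j] of [l] is then another one, and
     adding it keeps [e2 a = 1]. *)
  exists (delta_mx (inord 2) 0 + delta_mx j 0).
  rewrite !mulmxDr [X in X = 1]mxE [X in X != 0]mxE !cE l2 add0r !mxE !eqxx /=.
  by case: eqP => [h|_]; [rewrite h l2 eqxx in lj | rewrite addr0].
pose b := l - e2 R n.
have bE : b *m Emx R n = 0 by rewrite mulmxBl lE e2_Emx // subrr.
have ba : 1 + (b *m a) 0 0 = (l *m a) 0 0.
  by rewrite mulmxBl [X in 1 + X]mxE [X in _ + (_ + X)]mxE ea addrCA subrr addr0.
exists (1%:M + a *m b); split.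
- rewrite -row_free_unit; apply: inj_row_free => x; rewrite mulmxDr mulmx1 mulmxA.
  rewrite [x *m a]mx11_scalar mul_scalar_mx => h.
  have := congr1 (fun X => (X *m a) 0 0) h.
  rewrite mulmxDl -scalemxAl mul0mx mxE [X in _ + X]mxE [RHS]mxE.
  rewrite -{1}[(x *m a) 0 0]mulr1 -mulrDr ba => /eqP; rewrite mulf_eq0 (negbTE la) orbF.
  by move=> /eqP xa; rewrite xa scale0r addr0 in h.
- rewrite mulmxDr mulmx1 mulmxA [e2 R n *m a]mx11_scalar ea mul_scalar_mx scale1r.
  by rewrite addrC subrK.
- by rewrite mulmxDl mul1mx -mulmxA bE mulmx0 addr0.
Qed.

(** Gaussian elimination straightens the two functionals in [K] to combinations of the first two
    coordinates, hence their common kernel to the center. The image of [l] is then central, and a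
    transvection moves [e2] to it without disturbing those coordinates. *)
Lemma flag_basis (R : rcfType) n (K : 'M[R]_(2, n.+1)) (l : 'rV[R]_n.+1) : (2 <= n)%N ->
  row_free K -> l != 0 -> l *m K^T = 0 ->
  exists (B : 'M[R]_n.+1) (Q : 'M[R]_2),
    [/\ B \in unitmx, e2 R n *m B = l & K *m B^T = Q *m (Emx R n)^T].
Proof.
move=> n2 fK l0 lK.
have KE : K *m invmx (row_ebase K) = col_ebase K *m (Emx R n)^T.
  have -> : (Emx R n)^T = pid_mx 2.
    by apply/matrixP => i j; rewrite !mxE ltn_ord andbT eq_sym.
  rewrite -{1}[K]mulmx_ebase mulmxK ?row_ebase_unit //; congr (_ *m pid_mx _).
  exact/eqP.
pose B0 := (invmx (row_ebase K))^T.
have uB0 : B0 \in unitmx by rewrite unitmx_tr unitmx_inv row_ebase_unit.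
have lE : l *m invmx B0 *m Emx R n = 0.
  have uQ : (col_ebase K)^T \in unitmx by rewrite unitmx_tr col_ebase_unit.
  apply: (can_inj (mulmxK uQ)); rewrite mul0mx -!mulmxA.
  have -> : Emx R n *m (col_ebase K)^T = B0 *m K^T.
    by apply: trmx_inj; rewrite !trmx_mul !trmxK KE.
  by rewrite mulKmx.
have l1 : l *m invmx B0 != 0.
  by apply: contra_neq l0 => h; rewrite -[l](mulmxKV uB0) h mul0mx.
have [B1 [uB1 eB BE]] := transvect_to n2 l1 lE.
exists (B1 *m B0), (col_ebase K); split.
- by rewrite unitmx_mul uB1.
- by rewrite mulmxA eB mulmxKV.
- by rewrite trmx_mul trmxK mulmxA KE -mulmxA -trmx_mul BE.
Qed.

(** The form is first kept standard and the flag is found inside it: the first row of a frame of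
    type [t], and the orthogonal of its last two rows. A change of basis then makes this flag the
    standard one. *)
Lemma frame_realize (R : rcfType) n p q t : (p + q = n.+1)%N -> (2 <= n)%N ->
  t \in types -> (count (leq 1) t <= p)%N -> (count (geq 1) t <= q)%N ->
  exists2 M : 'M[R]_n.+1, hsig p q M & frame t M.
Proof.
move=> pq n2 tT tp tq; have [_ t2 th] := types_prop tT.
have [F fF FE] := std_frame_types R pq t2 tp tq.
set D := diag_mx _ in FE.
pose K := Pmx R (size t) *m F *m D.
have fK : row_free K.
  by rewrite !row_free_mul ?Pmx_free ?types_size // row_free_unit sig_std_unit.
have l0 := Smx_mul_neq0 (ltnW (types_size tT)) fF.
(* The first row has to be orthogonal to the last two. For size 3 this is diagonality; for size 2 it
   is one of them, and its code 1 makes it null. *)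
have lK : Smx R (size t) *m F *m K^T = 0.
  rewrite /K !trmx_mul tr_diag_mx -/D !mulmxA -(mulmxA _ F) -(mulmxA _ (F *m D)) FE.
  apply/rowP => i; rewrite mul_mx_diag [LHS]mxE [RHS]mxE big1 // => j _; rewrite !mxE.
  case: eqP => [j0|_]; last by rewrite !mul0r.
  case: eqP => [h|_]; last by rewrite mulr0.
  have s2 : size t == 2 by rewrite eqn_leq types_size // andbT; move: h; rewrite j0; lia.
  by move: th; rewrite s2 /= j0 nth0 => /eqP ->; rewrite subrr mulr0 mul0r.
have [B [Q [uB eB KB]]] := flag_basis n2 fK l0 lK.
exists (B *m D *m B^T); first exact: hsig_of_std.
have FB : F *m invmx B *m (B *m D *m B^T) = F *m D *m B^T.
  by rewrite !mulmxA mulmxKV.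
exists (F *m invmx B), Q, 1; split.
- by rewrite row_free_mul // row_free_unit unitmx_inv.
- by rewrite mulmxA -eB mulmxK // scale1r.
- by rewrite -KB -mulmxA FB /K !mulmxA.
- rewrite FB trmx_mul -!mulmxA (mulmxA B^T) -(trmx_mul (invmx B) B).
  by rewrite mulVmx // trmx1 mul1mx mulmxA FE.
Qed.

(** Rows with codes at least 1 span a positive semidefinite subspace, of dimension at most [p];
    likewise for codes at most 1 and [q]. *)
Lemma frame_feasible (R : rcfType) n p q t (M : 'M[R]_n.+1) : (p + q = n.+1)%N ->
  hsig p q M -> frame t M -> (count (leq 1) t <= p)%N /\ (count (geq 1) t <= q)%N.
Proof.
move=> pq /(hsig_to_std pq) [A uA AM] [F [_ [_ [fF _ _ G]]]].
have f : row_free (F *m invmx A) by rewrite row_free_mul // row_free_unit unitmx_inv.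
have E : (F *m invmx A) *m diag_mx (sig_std R n.+1 p) *m (F *m invmx A)^T = diag_mx (tvec R t).
  rewrite -AM -G !mulmxA mulmxKV // trmx_mul -!mulmxA; congr (_ *m (_ *m _)).
  by rewrite mulmxA -trmx_mul mulVmx // trmx1 mul1mx.
have [cp cq] := card_sig_std R pq.
rewrite !count_card; split.
  rewrite -cp; apply: leq_trans (card_nonneg_le f E); apply/eq_leq/eq_card => i.
  by rewrite !inE mxE natr_sub1_ge0.
rewrite -cq; apply: leq_trans (card_nonpos_le f E); apply/eq_leq/eq_card => i.
by rewrite !inE mxE natr_sub1_le0.
Qed.

(** * Left-invariant metrics and automorphisms *)

Section Metrics.
Variables (R : realType) (n : nat).
Hypothesis n2 : (2 <= n)%N.
Local Notation V := 'rV[R]_n.+1.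
Local Notation c0 v := (v ord0 (inord 0)).
Local Notation c1 v := (v ord0 (inord 1)).
Local Notation e2 := (e2 R n).
Local Notation E := (Emx R n).

Lemma c0_e2 : c0 e2 = 0.
Proof. by have /rowP /(_ 0) := e2_Emx R n2; rewrite mul_Emx ?(ltnW n2) // [RHS]mxE. Qed.

Lemma c1_e2 : c1 e2 = 0.
Proof. by have /rowP /(_ 1) := e2_Emx R n2; rewrite mul_Emx ?(ltnW n2) // [RHS]mxE. Qed.

Lemma c0D (u v : V) : c0 (u + v) = c0 u + c0 v. Proof. by rewrite mxE. Qed.
Lemma c1D (u v : V) : c1 (u + v) = c1 u + c1 v. Proof. by rewrite mxE. Qed.
Lemma c0Z (a : R) (v : V) : c0 (a *: v) = a * c0 v. Proof. by rewrite mxE. Qed.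
Lemma c1Z (a : R) (v : V) : c1 (a *: v) = a * c1 v. Proof. by rewrite mxE. Qed.
Definition coordE := (c0D, c1D, c0Z, c1Z, c0_e2, c1_e2).

Lemma HmulE (a b : V) : Hmul a b = a + b + (c0 a * c1 b) *: e2.
Proof. by []. Qed.

Lemma is_diff_coord i (a : V) : is_diff a (fun v : V => v ord0 i : R) (fun v : V => v ord0 i : R).
Proof.
have lin : linear (fun v : V => v ord0 i : R) by move=> k u v; rewrite !mxE.
pose fM := GRing.isLinear.Build _ _ _ _ _ lin.
pose f : {linear V -> R} := HB.pack (fun v : V => v ord0 i : R) fM.
apply: DiffDef; first exact: differentiable_coord.
exact: (@diff_lin _ _ _ f a (@coord_continuous _ _ _ _ _)).
Qed.

Lemma is_diff_mulmx (A : 'M[R]_n.+1) (a : V) :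
  is_diff a (fun v : V => v *m A) (fun v : V => v *m A).
Proof.
have dA x : differentiable (fun v : V => v *m A) x.
  rewrite (_ : (fun v : V => v *m A) = \sum_(i < n.+1) (fun v : V => v ord0 i *: row i A)).
    by apply: differentiable_sum => i; apply: differentiableZl; exact: differentiable_coord.
  by apply/funext => v; rewrite fct_sumE mulmx_sum_row.
have cA : continuous (mulmxr A : V -> V).
  by move=> x; apply: differentiable_continuous; exact: dA.
apply: DiffDef; first exact: dA.
exact: (@diff_lin _ _ _ (mulmxr A) a cA).
Qed.

(** A family containing both the left translations and the automorphisms built below, so that one
    derivative computation serves both. *)
Definition qmap (A : 'M[R]_n.+1) (al be ga : R) (c : V) (v : V) : V :=
  v *m A + (al * (c0 v * c0 v) + be * (c1 v * c1 v) + ga * (c0 v * c1 v)) *: e2 + c.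

Lemma is_diff_qmap A al be ga c (a : V) :
  is_diff a (qmap A al be ga c) (fun x => x *m A +
    (al * (2 * (c0 a * c0 x)) + be * (2 * (c1 a * c1 x)) + ga * (c0 a * c1 x + c1 a * c0 x)) *: e2).
Proof.
have d0 := is_diff_coord (inord 0) a.
have d1 := is_diff_coord (inord 1) a.
have dA := is_diff_mulmx A a.
set f0 := (fun v : V => c0 v : R) in d0; set f1 := (fun v : V => c1 v : R) in d1.
pose dqa : V -> R := al *: (f0 a *: f0 + f0 a *: f0) + be *: (f1 a *: f1 + f1 a *: f1)
  + ga *: (f0 a *: f1 + f1 a *: f0).
have dq : is_diff a (al *: (f0 * f0) + be *: (f1 * f1) + ga *: (f0 * f1)) dqa.
  exact: is_diffD (is_diffD (is_diffZ _ (is_diffM d0 d0)) (is_diffZ _ (is_diffM d1 d1)))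
    (is_diffZ _ (is_diffM d0 d1)).
have dqe : is_diff a (fun v => (al *: (f0 * f0) + be *: (f1 * f1) + ga *: (f0 * f1)) v *: e2)
    (fun x => dqa x *: e2).
  apply: DiffDef; first by apply: differentiableZl; exact: ex_diff.
  rewrite diffZl; last exact: ex_diff.
  by apply/funext => x; rewrite (@diff_val _ _ _ _ _ _ _ dq).
have dc : is_diff a (cst c) 0 := is_diff_cst c a.
apply: (is_diff_eq (is_diffD (is_diffD dA dqe) dc)).
apply/funext => x; rewrite /dqa !fctE /=.
rewrite addr0; congr (_ + _ *: _).
by rewrite /f0 /f1 /GRing.scale /=; ring.
Qed.

(** The differential of a left translation whose base point has first coordinate [b]; it is the same
    at every point. *)
Definition Tm (b : R) : 'M[R]_n.+1 := 1%:M + b *: delta_mx (inord 1) (inord 2).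

Lemma mul_Tm (x : V) b : x *m Tm b = x + (b * c1 x) *: e2.
Proof.
rewrite /Tm mulmxDr mulmx1 -scalemxAr -scalerA; congr (_ + _ *: _).
apply/rowP => j; rewrite mxE (bigD1 (inord 1)) //= big1 ?addr0 => [|k /negbTE ki].
  by rewrite !mxE !eqxx.
by rewrite mxE ki mulr0.
Qed.

Lemma TmD a b : Tm a *m Tm b = Tm (a + b).
Proof.
apply/row_matrixP => i; rewrite row_mul mul_Tm !rowE !mul_Tm !coordE mulr0 addr0.
by rewrite -addrA -scalerDl mulrDl.
Qed.

Lemma Tm0 : Tm 0 = 1%:M. Proof. by rewrite /Tm scale0r addr0. Qed.

Lemma Tm_unit b : Tm b \in unitmx.
Proof. by have [] := @mulmx1_unit _ _ (Tm b) (Tm (- b)); rewrite // TmD subrr Tm0. Qed.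

Lemma diff_Hmul b a x : 'd (Hmul b : V -> V) a x = x *m Tm (c0 b).
Proof.
have -> : (Hmul b : V -> V) = qmap (Tm (c0 b)) 0 0 0 b.
  apply/funext => v; rewrite HmulE /qmap mul_Tm !mul0r !addr0 scale0r addr0.
  by rewrite -addrA addrC.
have dq := @is_diff_qmap (Tm (c0 b)) 0 0 0 b a.
by rewrite (@diff_val _ _ _ _ _ _ _ dq) !mul0r !addr0 scale0r addr0.
Qed.

(** The tangent space at [a] is brought back to the identity by the inverse of [a], whose first
    coordinate is [- c0 a]. *)
Definition li_std (M : 'M[R]_n.+1) (a : V) : 'M[R]_n.+1 := Tm (- c0 a) *m M *m (Tm (- c0 a))^T.

Lemma formE (M : 'M[R]_n.+1) x y : Defs.form M x y = bil M x y. Proof. by []. Qed.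

Lemma li_std0 M : li_std M 0 = M.
Proof. by rewrite /li_std mxE oppr0 Tm0 trmx1 mul1mx mulmx1. Qed.

Lemma li_std_metric p q M : (p + q = n.+1)%N -> hsig p q M -> li_metric p q (li_std M).
Proof.
move=> pq sM; split=> [a|b a x y]; first exact: (hsig_congr pq (Tm_unit _) sM).
rewrite !diff_Hmul !formE -bil_mul; congr (bil _ x y); rewrite /li_std.
rewrite !mulmxA TmD -[RHS]mulmxA -trmx_mul TmD HmulE !coordE mulr0 addr0.
by rewrite opprD addNKr.
Qed.

Lemma li_metricE p q g : li_metric p q g -> forall b, g b = li_std (g 0) b.
Proof.
move=> [_ li] b.
have g0E : g 0 = Tm (c0 b) *m g b *m (Tm (c0 b))^T.
  apply: bilP => x y; rewrite bil_mul -!formE (li b).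
  have z1 : c1 (0 : V) = 0 by rewrite mxE.
  by rewrite !diff_Hmul HmulE addr0 z1 mulr0 scale0r addr0.
rewrite /li_std g0E !mulmxA TmD addNr Tm0 mul1mx -mulmxA -trmx_mul TmD addNr Tm0.
by rewrite trmx1 mulmx1.
Qed.

End Metrics.

Lemma det2 (R : comNzRingType) (Q : 'M[R]_2) : \det Q = Q 0 0 * Q 1 1 - Q 0 1 * Q 1 0.
Proof.
rewrite (expand_det_row _ 0) !big_ord_recl big_ord0 addr0 /cofactor !det_mx11 !mxE /=.
rewrite expr0 expr1 mul1r mulN1r mulrN.
by congr (_ * Q _ _ - Q _ _ * Q _ _); apply: val_inj.
Qed.

Section Equiv.
Variables (R : realType) (n : nat).
Hypothesis n2 : (2 <= n)%N.
Local Notation V := 'rV[R]_n.+1.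
Local Notation c0 v := (v ord0 (inord 0)).
Local Notation c1 v := (v ord0 (inord 1)).
Local Notation e2 := (e2 R n).
Local Notation E := (Emx R n).
Let coordE := coordE R n2.

Lemma ker_Emx (v : V) : (v *m E = 0) <-> (c0 v = 0 /\ c1 v = 0).
Proof.
split=> [h|[h0 h1]].
  have := mul_Emx v (0 : 'I_2) (ltnW n2); have := mul_Emx v (1 : 'I_2) (ltnW n2).
  by rewrite h !mxE => <- <-.
apply/rowP => j; rewrite mul_Emx ?(ltnW n2) // [RHS]mxE.
by case: j => [[|[|j]] hj] //.
Qed.

Lemma coord01 : exists e0 e1 : V, [/\ c0 e0 = 1, c1 e0 = 0, c0 e1 = 0 & c1 e1 = 1].
Proof.
have n1 : (1 < n.+1)%N by apply: leqW.
have h : (inord 0 == inord 1 :> 'I_n.+1) = false.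
  by apply/eqP => /(congr1 val) /=; rewrite !inordK.
exists (delta_mx ord0 (inord 0)), (delta_mx ord0 (inord 1)).
by rewrite !mxE !eqxx h eq_sym h.
Qed.

(** * The differential of a group automorphism preserves the flag *)

Section Automorphism.
Variable phi : V -> V.
Hypothesis autphi : lie_aut phi.

Let phiM a b : phi (Hmul a b) = Hmul (phi a) (phi b). Proof. by case: autphi => _ []. Qed.

Lemma aut0 : phi 0 = 0.
Proof.
have := phiM 0 0; rewrite [in LHS]HmulE mxE mul0r scale0r !addr0 => h.
have h0 : c0 (phi 0) = 0.
  have := congr1 (fun v : V => c0 v) h; rewrite HmulE !coordE mulr0 addr0 => h1.
  by apply/eqP; rewrite -(inj_eq (addrI (c0 (phi 0)))) -h1 addr0.
move: h; rewrite HmulE h0 mul0r scale0r addr0 => h1.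
by apply/eqP; rewrite -(inj_eq (addrI (phi 0))) -h1 addr0.
Qed.

Lemma aut_center (z : V) : c0 z = 0 -> c1 z = 0 -> c0 (phi z) = 0 /\ c1 (phi z) = 0.
Proof.
move=> z0 z1; have [[psi _ phiK] _] := autphi.
(* As [phi] is onto, [phi z] commutes with every [w]; the two products can differ only along
   [e2]. *)
have com (w : V) : c0 (phi z) * c1 w = c0 w * c1 (phi z).
  have : phi (Hmul z (psi w)) = phi (Hmul (psi w) z).
    by congr phi; rewrite !HmulE z0 z1 mul0r mulr0 scale0r !addr0 addrC.
  rewrite !phiM phiK !HmulE [w + _]addrC => /addrI /eqP.
  by rewrite -subr_eq0 -scalerBl scaler_eq0 (negbTE (e2_neq0 R n)) orbF subr_eq0 => /eqP.
have [e0 [e1 [e00 e01 e10 e11]]] := coord01.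
split; first by have := com e1; rewrite e11 e10 mulr1 mul0r.
by have := com e0; rewrite e01 e00 mulr0 mul1r => <-.
Qed.

(** [h *: e2] is the commutator of [h *: e0] and [e1], its image is again a commutator, and products
    in opposite orders differ only along [e2]. *)
Lemma aut_commutator h : exists k, phi (h *: e2) = k *: e2.
Proof.
have [e0 [e1 [e00 e01 e10 e11]]] := coord01.
have zc : c0 (phi (h *: e2)) = 0.
  by have [] := @aut_center (h *: e2); rewrite ?coordE ?mulr0.
have : phi (Hmul (h *: e0) e1) = phi (Hmul (h *: e2) (Hmul e1 (h *: e0))).
  congr phi; rewrite !HmulE !coordE e00 e01 e10 e11 !(mulr0, mul0r, mulr1, scale0r, addr0).
  by rewrite [RHS]addrC [e1 + _]addrC.
rewrite !phiM !HmulE zc mul0r scale0r addr0.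
move: (phi (h *: e0)) (phi e1) => x y eq.
exists (c0 x * c1 y - c0 y * c1 x).
have -> : phi (h *: e2) = (x + y + (c0 x * c1 y) *: e2) - (y + x + (c0 y * c1 x) *: e2).
  by rewrite eq addrK.
by rewrite [y + x]addrC opprD addrACA subrr add0r scalerBl.
Qed.

(** [phi] need not be linear in these coordinates, so the group identities only concern the curves
    [phi (h *: v)]; the chain rule at [h = 0] passes them on to the differential. *)
Lemma diff_coord_eq0 (v : V) i : (forall h : R, phi (h *: v) ord0 i = 0) ->
  ('d phi (0 : V) v) ord0 i = 0.
Proof.
move=> hv; have [_ [_ dphi]] := autphi.
pose f := (fun u : V => u ord0 i : R) \o (phi \o (fun h : R => h *: v)).
have fE : f = cst 0 by apply/funext => h; exact: hv.
have d1 : is_diff (0 : R) (fun h : R => h *: v) (fun h : R => h *: v) := is_diff_scalel 0 v.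
have d2 : is_diff (0 *: v) phi ('d phi (0 *: v)).
  by apply: differentiableP; exact: dphi.
have d3 := is_diff_coord i (phi (0 *: v)).
have d12 := is_diff_comp d1 d2.
have d123 := is_diff_comp d12 d3.
have := @diff_val _ _ _ _ _ _ _ d123; rewrite -/f fE diff_cst => /(congr1 (fun g => g 1)).
by rewrite /= scale1r scale0r => /esym.
Qed.

Lemma aut_jacobian : exists (J : 'M[R]_n.+1) (Q : 'M[R]_2) mu,
  [/\ forall x, 'd phi (0 : V) x = x *m J, e2 *m J = mu *: e2 & J *m E = E *m Q].
Proof.
pose J := lin1_mx ('d phi (0 : V)).
have JE x : 'd phi (0 : V) x = x *m J by rewrite mul_rV_lin1.
exists J, (E^T *m J *m E), ((e2 *m J) ord0 (inord 2)); split=> //.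
  apply/rowP => j; rewrite [RHS]mxE [e2 _ _]mxE eqxx /=.
  have [->|j2] := eqVneq j (inord 2); first by rewrite mulr1.
  rewrite mulr0 -JE; apply: diff_coord_eq0 => h.
  by have [k ->] := aut_commutator h; rewrite !mxE (negbTE j2) andbF mulr0.
have Z (z : V) : z *m E = 0 -> z *m J *m E = 0.
  move=> /ker_Emx [z0 z1]; apply/ker_Emx; rewrite -JE.
  by split; apply: diff_coord_eq0 => h;
    have [] := @aut_center (h *: z); rewrite ?coordE ?z0 ?z1 ?mulr0.
apply/row_matrixP => i; rewrite !rowE !mulmxA; set x := delta_mx 0 i.
(* [x] and [x *m E *m E^T] differ by a central vector, so [x *m J *m E] depends on [x *m E] only. *)
have zE : (x - x *m E *m E^T) *m E = 0.
  by rewrite mulmxBl -(mulmxA (x *m E)) Emx_trK ?(ltnW n2) // mulmx1 subrr.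
by have := Z _ zE; rewrite !mulmxBl => /eqP; rewrite subr_eq0 => /eqP.
Qed.

End Automorphism.

Lemma flag_equiv_of_metric p q (g1 g2 : V -> 'M[R]_n.+1) : (p + q = n.+1)%N ->
  li_metric p q g1 -> li_metric p q g2 -> metric_equiv g1 g2 -> flag_equiv (g1 0) (g2 0).
Proof.
move=> pq l1 l2 [c [phi [c_gt0 [aut eqv]]]].
have [J [Q [mu [JE Je JQ]]]] := aut_jacobian aut.
have sc : Num.sqrt c != 0 by rewrite sqrtr_eq0 -ltNge.
have MJ : (Num.sqrt c *: J) *m g2 0 *m (Num.sqrt c *: J)^T = g1 0.
  apply: bilP => x y; rewrite bil_mul -!scalemxAr !bil_lin mulrA -expr2 sqr_sqrtr ?ltW //.
  by have := eqv 0 x y; rewrite (aut0 aut) !JE !formE => ->.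
exists (Num.sqrt c *: J), (Num.sqrt c *: Q), (Num.sqrt c * mu); split=> //.
- have : g1 0 \in unitmx by apply: (hsig_unit pq); case: l1 => /(_ 0).
  by rewrite -MJ !unitmx_mul => /andP [/andP []].
- by rewrite -scalemxAr Je scalerA.
- by rewrite -scalemxAl -scalemxAr JQ.
Qed.

(** * From a flag-preserving map to a group automorphism *)

Section Construct.
Variables (A : 'M[R]_n.+1) (Q : 'M[R]_2) (mu : R).
Hypotheses (uA : A \in unitmx) (Ae : e2 *m A = mu *: e2) (AE : A *m E = E *m Q).
Hypothesis muE : mu = Q 0 0 * Q 1 1 - Q 0 1 * Q 1 0.

(* The quadratic correction turns the Lie algebra automorphism [A] into a group automorphism
   for the non-exponential coordinates used in [Hmul]. *)
Definition aut_of : V -> V :=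
  qmap A (Q 0 0 * Q 0 1 / 2) (Q 1 0 * Q 1 1 / 2) (Q 0 1 * Q 1 0) 0.

Lemma aut_ofE v : aut_of v = v *m A + (Q 0 0 * Q 0 1 / 2 * (c0 v * c0 v) +
  Q 1 0 * Q 1 1 / 2 * (c1 v * c1 v) + Q 0 1 * Q 1 0 * (c0 v * c1 v)) *: e2.
Proof. exact: addr0. Qed.

Lemma c0_mulA (v : V) : c0 (v *m A) = c0 v * Q 0 0 + c1 v * Q 1 0.
Proof.
have := mul_Emx (v *m A) (0 : 'I_2) (ltnW n2) => <-.
rewrite -mulmxA AE mulmxA mxE !big_ord_recl big_ord0 addr0.
by rewrite (_ : lift ord0 ord0 = 1); [rewrite !mul_Emx ?(ltnW n2) | exact: val_inj].
Qed.

Lemma c1_mulA (v : V) : c1 (v *m A) = c0 v * Q 0 1 + c1 v * Q 1 1.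
Proof.
have := mul_Emx (v *m A) (1 : 'I_2) (ltnW n2) => <-.
rewrite -mulmxA AE mulmxA mxE !big_ord_recl big_ord0 addr0.
by rewrite (_ : lift ord0 ord0 = 1); [rewrite !mul_Emx ?(ltnW n2) | exact: val_inj].
Qed.

Lemma mu_neq0 : mu != 0.
Proof.
apply: contra_neq (e2_neq0 R n) => h; rewrite -[e2](mulmxK uA) Ae h scale0r mul0mx //.
Qed.

Lemma aut_of_lie_aut : lie_aut aut_of.
Proof.
have aut0D v : c0 (aut_of v) = c0 (v *m A).
  by rewrite aut_ofE !coordE mulr0 addr0.
split; last split.
- pose qf (v : V) : R := Q 0 0 * Q 0 1 / 2 * (c0 v * c0 v) + Q 1 0 * Q 1 1 / 2 * (c1 v * c1 v) +
    Q 0 1 * Q 1 0 * (c0 v * c1 v).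
  have aE v : aut_of v = v *m A + qf v *: e2 by exact: aut_ofE.
  have eA : e2 *m invmx A = mu^-1 *: e2.
    apply: (can_inj (mulmxK uA)); rewrite mulmxKV // -scalemxAl Ae scalerA mulVf ?mu_neq0 //.
    by rewrite scale1r.
  have qfD v (k : R) : qf (v + k *: e2) = qf v by rewrite /qf !coordE !mulr0 !addr0.
  exists (fun w => w *m invmx A - (qf (w *m invmx A) / mu) *: e2) => v.
    rewrite aE mulmxDl mulmxK // -scalemxAl eA scalerA qfD.
    by rewrite addrK.
  rewrite aE -scaleNr qfD mulmxDl mulmxKV // -scalemxAl Ae scalerA mulNr divfK ?mu_neq0 //.
  by rewrite scaleNr subrK.
(* Along [e2] the polarization of the quadratic term must equal [c0 (a A) c1 (b A) - mu c0 a c1 b].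
   This is symmetric in [a] and [b] because [mu = \det Q], and the coefficients in [aut_of] are
   those of the resulting quadratic form. *)
- move=> a b; rewrite [Hmul (aut_of a) _]HmulE aut0D.
  have -> : c1 (aut_of b) = c1 (b *m A) by rewrite aut_ofE !coordE mulr0 addr0.
  rewrite c0_mulA c1_mulA !aut_ofE HmulE !coordE !mulr0 !addr0.
  rewrite !mulmxDl -scalemxAl Ae scalerA muE.
  rewrite [X in _ = X + _]addrACA -!addrA; congr (_ + (_ + _)); rewrite -!scalerDl; congr (_ *: _).
  by field.
- by move=> a; have [] := is_diff_qmap A (Q 0 0 * Q 0 1 / 2) (Q 1 0 * Q 1 1 / 2) (Q 0 1 * Q 1 0) 0 a.
Qed.

(** An automorphism intertwines left translations, so its differential at [a] goes back to the
    identity, applies [A] and moves on to [aut_of a]. Between metrics of the form [li_std] the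
    translations cancel and only [A] remains. *)
Lemma diff_aut_of a x : 'd aut_of a x = x *m Tm n (- c0 a) *m A *m Tm n (c0 (aut_of a)).
Proof.
have dq := is_diff_qmap A (Q 0 0 * Q 0 1 / 2) (Q 1 0 * Q 1 1 / 2) (Q 0 1 * Q 1 0) 0 a.
rewrite (@diff_val _ _ _ _ _ _ _ dq).
have -> : c0 (aut_of a) = c0 (a *m A) by rewrite aut_ofE !coordE mulr0 addr0.
rewrite !mul_Tm // mulmxDl -scalemxAl Ae scalerA !coordE mulr0 addr0 c1_mulA c0_mulA.
rewrite -[RHS]addrA -scalerDl muE; congr (_ + _ *: _).
by field.
Qed.

End Construct.

Lemma metric_of_flag_equiv p q (g1 g2 : V -> 'M[R]_n.+1) :
  li_metric p q g1 -> li_metric p q g2 -> flag_equiv (g1 0) (g2 0) -> metric_equiv g1 g2.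
Proof.
move=> l1 l2 [A [Q [mu [uA AM Ae AE]]]].
have uQ := Emx_intertwiner_unit (ltnW n2) uA AE.
have mu0 := mu_neq0 uA Ae.
pose de := Q 0 0 * Q 1 1 - Q 0 1 * Q 1 0.
have de0 : de != 0 by move: uQ; rewrite unitmxE unitfE det2.
(* Dividing [A] by [la] divides [mu] by [la] and [\det Q] by its square, so the two become equal for
   this value; the metric picks up the positive factor [la ^+ 2]. *)
pose la := de / mu.
have la0 : la != 0 by exact: mulf_neq0 de0 (invr_neq0 mu0).
pose A' := la^-1 *: A; pose Q' := la^-1 *: Q; pose mu' := la^-1 * mu.
have uA' : A' \in unitmx by rewrite unitmxZ // unitfE invr_neq0.
have Ae' : e2 *m A' = mu' *: e2 by rewrite -scalemxAr Ae scalerA.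
have AE' : A' *m E = E *m Q' by rewrite -scalemxAl -scalemxAr AE.
have muE' : mu' = Q' 0 0 * Q' 1 1 - Q' 0 1 * Q' 1 0.
  rewrite !mxE; transitivity (la^-1 * la^-1 * de); last by rewrite /de; ring.
  by rewrite /mu' /la; field; rewrite mu0 de0.
exists (la ^+ 2), (aut_of A' Q'); split; last split.
- by rewrite lt_neqAle sqr_ge0 andbT eq_sym sqrf_eq0.
- exact: aut_of_lie_aut uA' Ae' AE' muE'.
move=> a x y; rewrite !formE !(diff_aut_of Ae' AE' muE').
rewrite (li_metricE n2 l1) (li_metricE n2 l2) /li_std -AM.
rewrite !bil_mul -!mulmxA !TmD // subrr Tm0 !mulmx1 !mulmxA.
have -> : A = la *: A' by rewrite scalerA mulfV // scale1r.
rewrite -!scalemxAr !bil_lin; field; apply: la0.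
Qed.

(** * Counting the classes *)

Definition feasible p q : seq (seq nat) :=
  [seq t <- types | (count (leq 1) t <= p) && (count (geq 1) t <= q)]%N.

Lemma num_classes_feasible p q : (p + q = n.+1)%N ->
  num_classes R n p q (size (feasible p q)).
Proof.
move=> pq; set L := feasible p q.
have uL : uniq L by apply: filter_uniq.
have LP t : t \in L = [&& (count (leq 1) t <= p)%N, (count (geq 1) t <= q)%N & t \in types].
  by rewrite mem_filter andbA.
have ex (i : 'I_(size L)) : exists M : 'M[R]_n.+1, hsig p q M /\ frame (nth [::] L i) M.
  have : nth [::] L i \in L by rewrite mem_nth.
  rewrite LP => /and3P [tp tq tT].
  by have [M sM fM] := frame_realize R pq n2 tT tp tq; exists M.
have [m mP] := fin_all_exists ex.
exists (fun i => li_std (m i)); split; last split.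
- by move=> i; apply: li_std_metric => //; case: (mP i).
- move=> i j /negP ij meq; apply: ij.
  have [si fi] := mP i; have [sj fj] := mP j.
  have := flag_equiv_of_metric pq (li_std_metric n2 pq si) (li_std_metric n2 pq sj) meq.
  rewrite !li_std0 => /(frame_flag_equiv n2) /(_ fi) fi'.
  have tT (k : 'I_(size L)) : nth [::] L k \in types.
    by have : nth [::] L k \in L by [rewrite mem_nth]; rewrite LP => /and3P [].
  have /eqP := frame_uniq pq sj (tT i) (tT j) fi' fj.
  by rewrite nth_uniq.
move=> g lg; have sg : hsig p q (g 0) by case: lg => /(_ 0).
have [t tT ft] := frame_exists n2 (proj1 sg) (hsig_unit pq sg).
have [tp tq] := frame_feasible pq sg ft.
have tL : t \in L by rewrite LP tp tq.
have iL : (index t L < size L)%N by rewrite index_mem.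
exists (Ordinal iL); have [sm fm] := mP (Ordinal iL).
apply: (metric_of_flag_equiv lg (li_std_metric n2 pq sm)); rewrite li_std0.
move: fm; rewrite /= nth_index // => fm.
exact: (flag_equiv_of_frame pq n2 (types_size tT) sg sm ft fm).
Qed.

End Equiv.

(* G = H_3 x R^(p+q-3), modelled on 'rV[R]_(p+q) = 'rV[R]_(p+q-1).+1 *)
Theorem theorem1p2 (R : realType) (p q : nat) :
  (1 <= p)%N -> (1 <= q)%N -> (4 <= p + q)%N ->
  ((3 <= p)%N -> (3 <= q)%N -> num_classes R (p + q).-1 p q 21) /\
  ((3 <= p)%N -> q = 2%N -> num_classes R (p + q).-1 p q 15) /\
  ((3 <= p)%N -> q = 1%N -> num_classes R (p + q).-1 p q 6) /\
  (p = 2%N -> q = 2%N -> num_classes R (p + q).-1 p q 10).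
Proof.
move=> p1 q1 pq4.
have nc k : size (feasible p q) = k -> num_classes R (p + q).-1 p q k.
  by move=> <-; apply: num_classes_feasible; lia.
split; last split; last split.
(* A type has at most three entries, so exposing three successors of [p] and [q] lets the list
   compute with the rest left symbolic. *)
- case: p q nc {p1 q1 pq4} => [|[|[|p]]] // [|[|[|q]]] // nc _ _.
  by apply: nc; vm_compute.
- by case: p nc {p1 pq4} => [|[|[|p]]] // nc _ q2; subst q; apply: nc; vm_compute.
- by case: p nc {p1 pq4} => [|[|[|p]]] // nc _ q2; subst q; apply: nc; vm_compute.
- by move=> p2 q2; subst p q; apply: nc; vm_compute.
Qed.
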